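(* Let $0<\lambda<1/e$, $E(z)=\lambda e^z$, let $x_0>\beta$ and $z\in\mathcal J(E)\setminus\mathcal C$. Then there exist $\varepsilon>0$ and $k\in\mathbb N$ such that $E^k(z)\in\mathcal X(x_0,L^\varepsilon)$, where $\mathcal X(x_0,L^\varepsilon)=\{w\in\mathbb C:\operatorname{Re}E^j(w)>E^j(x_0)\text{ and }x_0<\operatorname{Re}E^j(w),\ |\operatorname{Im}E^j(w)|<L^\varepsilon(\operatorname{Re}E^j(w))\text{ for all }j\in\mathbb N\}$.
   Context: For $0<\lambda<1/e$, $E(z)=\lambda e^z$ has real fixed points $\alpha<1<\beta$ ($\alpha$ attracting, $\beta$ repelling, $E'(\beta)=\beta$). $\mathcal J(E)$ is the Julia set; by Devaney–Krych it is a union of pairwise disjoint curves (''hairs'') each joining a finite endpoint to $\infty$, each hair being the set of points of $\mathcal J(E)$ with a given itinerary (the sequence $(s_j)$ with $(2s_j-1)\pi\le\operatorname{Im}E^j(z)<(2s_j+1)\pi$); $\mathcal C$ is the set of endpoints of the hairs. Fractional iterates: $S$ is the entire solution of $S(\beta z)=E(S(z))$ with $S(0)=\beta$, $S'(0)=1$, an increasing bijection $\mathbb R\to(\alpha,\infty)$; for $r\in\mathbb R$, $E^r(\alpha)=\alpha$, $E^r(x)=S(\beta^rS^{-1}(x))$ for $x>\alpha$, and $L^r=E^{-r}$ (so $L(x)=\log x-\log\lambda$). *)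

(* Defs.v *)
From Stdlib Require Import Reals Lra ZArith.
Open Scope R_scope.

Definition Cx : Type := (R * R)%type.
Definition Re (z : Cx) : R := fst z.
Definition Im (z : Cx) : R := snd z.
Definition cnorm (z : Cx) : R := sqrt (Re z ^ 2 + Im z ^ 2).
Definition cdist (z w : Cx) : R := cnorm (Re z - Re w, Im z - Im w).

Definition cexp (z : Cx) : Cx := (exp (Re z) * cos (Im z), exp (Re z) * sin (Im z)).

Definition Efun (lam : R) (z : Cx) : Cx := (lam * Re (cexp z), lam * Im (cexp z)).

Fixpoint Eiter (lam : R) (n : nat) (z : Cx) : Cx :=
  match n with O => z | S m => Efun lam (Eiter lam m z) end.

Definition strictly_incr (f : nat -> nat) : Prop := forall k, (f k < f (S k))%nat.

(* Fatou set: the iterates form a normal family on a neighbourhood of z, i.e.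
   on some disc D(z,r) every sequence of iterates has a subsequence that converges
   locally uniformly (uniformly on every closed disc D(z,s), s<r) either to a
   finite function or to infinity. *)
Definition in_Fatou (lam : R) (z : Cx) : Prop :=
  exists r, 0 < r /\
    forall phi : nat -> nat, strictly_incr phi ->
      exists psi : nat -> nat, strictly_incr psi /\
        ((exists g : Cx -> Cx,
            forall s, 0 < s < r -> forall eps, 0 < eps ->
              exists N, forall k w, (N <= k)%nat -> cdist w z <= s ->
                cdist (Eiter lam (phi (psi k)) w) (g w) < eps)
         \/
         (forall s, 0 < s < r -> forall M,
              exists N, forall k w, (N <= k)%nat -> cdist w z <= s ->
                M < cnorm (Eiter lam (phi (psi k)) w))).

Definition in_Julia (lam : R) (z : Cx) : Prop := ~ in_Fatou lam z.

Definition in_strip (s : Z) (w : Cx) : Prop :=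
  (2 * IZR s - 1) * PI <= Im w < (2 * IZR s + 1) * PI.

Definition same_itinerary (lam : R) (z w : Cx) : Prop :=
  forall (j : nat) (s : Z), in_strip s (Eiter lam j z) <-> in_strip s (Eiter lam j w).

Definition hair (lam : R) (z w : Cx) : Prop := in_Julia lam w /\ same_itinerary lam z w.

Definition is_endpoint (lam : R) (z : Cx) : Prop :=
  in_Julia lam z /\
  exists gamma : R -> Cx,
    gamma 0 = z /\
    (forall t, 0 <= t -> hair lam z (gamma t)) /\
    (forall w, hair lam z w -> exists t, 0 <= t /\ gamma t = w) /\
    (forall t, 0 <= t -> continuity_pt (fun u => Re (gamma u)) t /\
                        continuity_pt (fun u => Im (gamma u)) t) /\
    (forall t u, 0 <= t -> 0 <= u -> gamma t = gamma u -> t = u) /\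
    (forall M, exists T, forall t, T <= t -> M < cnorm (gamma t)).

(* L^eps(x) = S(beta^(-eps) S^{-1}(x)); "|Im v| < L^eps(Re v)" is written as
   exists t, S t = Re v /\ |Im v| < S(beta^(-eps) t)  (S is injective). *)
Definition in_X (lam beta : R) (S : R -> R) (x0 eps : R) (w : Cx) : Prop :=
  forall j : nat,
    Re (Eiter lam j (x0, 0)) < Re (Eiter lam j w) /\
    x0 < Re (Eiter lam j w) /\
    exists t, S t = Re (Eiter lam j w) /\
              Rabs (Im (Eiter lam j w)) < S (Rpower beta (- eps) * t).

(* Main.v *)
(** Points of the Julia set are those whose orbits stay in [Re >= beta], where
    every branch of the logarithm contracts by [1/beta].  Hence along two orbits
    with the same itinerary the difference of the real parts is unbounded, and one
    orbit eventually leads the other by an ever growing amount: each hair is totally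
    ordered.  If [z] leads [v], then [Im E^n(z)] is within [PI] of [Im E^n(v)], which
    is at most [E^n] of a real number smaller than the one whose iterates bound
    [Re E^n(z)] from below; measured by [S], this is the conclusion.

    It remains to see that a point [z] minimal in its hair is an endpoint.  With [t0]
    the escape rate [lim beta^(-n) S^(-1)(|E^n(z)|)], pulling [S (beta^n t) + i Im E^n(z)]
    back along the orbit of [z] converges, for each [t > t0], to the unique point of
    the hair of escape rate [t].  This is a curve through all points other than [z]; as
    [t] decreases to [t0] it converges, by monotonicity of the order, to a point of
    the hair which is not ahead of [z], that is, to [z]. *)
From Stdlib Require Import Reals Lra Lia ZArith Classical ClassicalEpsilon.
From Coquelicot Require Import Coquelicot.
Require Import Defs.
Open Scope R_scope.

(** * The Euclidean metric of the plane in coordinates *)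

Lemma cdist_triangle a b c : cdist a c <= cdist a b + cdist b c.
Proof.
  replace (cdist a c) with (Cmod ((a - b) + (b - c))%C).
  - exact (Cmod_triangle (a - b)%C (b - c)%C).
  - change (cdist a c) with (Cmod (a - c)%C); f_equal; ring.
Qed.

Lemma cdist_sym a b : cdist a b = cdist b a.
Proof. unfold cdist, cnorm, Re, Im; simpl; f_equal; ring. Qed.

Lemma cdist_pos a b : 0 <= cdist a b.
Proof. apply sqrt_pos. Qed.

Lemma cdist_eq a b : cdist a b = 0 -> a = b.
Proof.
  intros h; pose proof (Cmod_eq_0 (a - b)%C h) as h'.
  destruct a as [a1 a2], b as [b1 b2]; injection h' as h1 h2; simpl in h1, h2.
  f_equal; lra.
Qed.

Lemma Rabs_Re_le_cnorm a : Rabs (Re a) <= cnorm a.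
Proof. eapply Rle_trans; [apply Rmax_l | apply (Rmax_Cmod a)]. Qed.

Lemma Rabs_Im_le_cnorm a : Rabs (Im a) <= cnorm a.
Proof. eapply Rle_trans; [apply Rmax_r | apply (Rmax_Cmod a)]. Qed.

Lemma Rabs_Re_le_cdist a b : Rabs (Re a - Re b) <= cdist a b.
Proof. apply (Rabs_Re_le_cnorm (Re a - Re b, Im a - Im b)). Qed.

Lemma Rabs_Im_le_cdist a b : Rabs (Im a - Im b) <= cdist a b.
Proof. apply (Rabs_Im_le_cnorm (Re a - Re b, Im a - Im b)). Qed.

Lemma cnorm_sqr a : cnorm a * cnorm a = Re a ^ 2 + Im a ^ 2.
Proof. apply sqrt_sqrt; nra. Qed.

Lemma cnorm_pos a : 0 <= cnorm a.
Proof. apply sqrt_pos. Qed.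

Lemma cnorm_le a : cnorm a <= Rabs (Re a) + Rabs (Im a).
Proof.
  pose proof (cnorm_sqr a); pose proof (cnorm_pos a).
  pose proof (Rabs_pos (Re a)); pose proof (Rabs_pos (Im a)).
  pose proof (pow2_abs (Re a)); pose proof (pow2_abs (Im a)); nra.
Qed.

Lemma cdist_le a b : cdist a b <= Rabs (Re a - Re b) + Rabs (Im a - Im b).
Proof. apply (cnorm_le (Re a - Re b, Im a - Im b)). Qed.

Lemma cdist_sqr a b :
  cdist a b * cdist a b = (Re a - Re b) ^ 2 + (Im a - Im b) ^ 2.
Proof. apply (cnorm_sqr (Re a - Re b, Im a - Im b)). Qed.

Lemma pair_eq (a b : Cx) : Re a = Re b -> Im a = Im b -> a = b.
Proof. destruct a, b; unfold Re, Im; simpl; congruence. Qed.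

(** * Inverse branches of [E] on the right half-plane and their contraction *)

Definition carg (p : Cx) : R := atan (Im p / Re p).

(** For [c] a multiple of [2 PI] this is a right inverse of [E] on [Re > 0], where [carg] is the
    principal argument. *)
Definition clog (lam c : R) (p : Cx) : Cx := (ln (cnorm p / lam), c + carg p).

Lemma Re_clog lam c p : Re (clog lam c p) = ln (cnorm p / lam).
Proof. reflexivity. Qed.

Lemma Im_clog lam c p : Im (clog lam c p) = c + carg p.
Proof. reflexivity. Qed.

Lemma Re_Efun lam z : Re (Efun lam z) = lam * exp (Re z) * cos (Im z).
Proof. unfold Efun, cexp, Re, Im; simpl; ring. Qed.

Lemma Im_Efun lam z : Im (Efun lam z) = lam * exp (Re z) * sin (Im z).
Proof. unfold Efun, cexp, Re, Im; simpl; ring. Qed.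

Lemma carg_bound p : - PI / 2 < carg p < PI / 2.
Proof. apply atan_bound. Qed.

Lemma Re_le_cnorm p : Re p <= cnorm p.
Proof. eapply Rle_trans; [apply Rle_abs | apply Rabs_Re_le_cnorm]. Qed.

Lemma polar p : 0 < Re p ->
  Re p = cnorm p * cos (carg p) /\ Im p = cnorm p * sin (carg p).
Proof.
  intros h; unfold carg; rewrite cos_atan, sin_atan.
  assert (hs : cnorm p = Re p * sqrt (1 + Rsqr (Im p / Re p))).
  { unfold cnorm; rewrite <- (sqrt_pow2 (Re p)) at 2 by lra.
    rewrite <- sqrt_mult by (unfold Rsqr; nra).
    f_equal; unfold Rsqr; field; lra. }
  assert (0 < sqrt (1 + Rsqr (Im p / Re p))).
  { apply sqrt_lt_R0; pose proof (Rle_0_sqr (Im p / Re p)); lra. }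
  rewrite hs; split; field; lra.
Qed.

Lemma cnorm_Efun lam z : 0 < lam -> cnorm (Efun lam z) = lam * exp (Re z).
Proof.
  intros h; unfold Efun, cexp, cnorm, Re, Im; simpl.
  pose proof (sin2_cos2 (snd z)) as hc; unfold Rsqr in hc.
  replace (_ + _) with (Rsqr (lam * exp (fst z))).
  - apply sqrt_Rsqr; pose proof (exp_pos (fst z)); nra.
  - unfold Rsqr.
    transitivity (lam * exp (fst z) * (lam * exp (fst z)) *
      (sin (snd z) * sin (snd z) + cos (snd z) * cos (snd z)));
      [rewrite hc; ring | ring].
Qed.

Lemma Efun_clog lam c p : 0 < lam -> cos c = 1 -> sin c = 0 -> 0 < Re p ->
  Efun lam (clog lam c p) = p.
Proof.
  intros hl hc hs hp; destruct (polar p hp) as [h1 h2].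
  pose proof (Re_le_cnorm p).
  assert (0 < cnorm p / lam) by (apply Rdiv_lt_0_compat; lra).
  apply pair_eq; rewrite ?Re_Efun, ?Im_Efun, Re_clog, Im_clog, exp_ln by auto;
    rewrite ?cos_plus, ?sin_plus, hc, hs.
  - rewrite h1; field; lra.
  - rewrite h2; field; lra.
Qed.

Lemma phase_trig lam z : 0 < lam -> 0 < Re (Efun lam z) ->
  cos (Im z - carg (Efun lam z)) = 1 /\ sin (Im z - carg (Efun lam z)) = 0.
Proof.
  intros hl hp; destruct (polar _ hp) as [h1 h2].
  rewrite cnorm_Efun in h1, h2 by auto.
  pose proof (exp_pos (Re z)).
  rewrite Re_Efun in h1; rewrite Im_Efun in h2.
  assert (e1 : cos (Im z) = cos (carg (Efun lam z))).
  { apply (Rmult_eq_reg_l (lam * exp (Re z))); [lra | nra]. }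
  assert (e2 : sin (Im z) = sin (carg (Efun lam z))).
  { apply (Rmult_eq_reg_l (lam * exp (Re z))); [lra | nra]. }
  rewrite cos_minus, sin_minus, e1, e2.
  pose proof (sin2_cos2 (carg (Efun lam z))) as hh; unfold Rsqr in hh; split; lra.
Qed.

Lemma clog_Efun lam z : 0 < lam ->
  clog lam (Im z - carg (Efun lam z)) (Efun lam z) = z.
Proof.
  intros hl; unfold clog; rewrite cnorm_Efun by auto.
  apply pair_eq; unfold Re at 1, Im at 1; simpl; [|ring].
  replace (lam * exp (Re z) / lam) with (exp (Re z)) by (field; lra).
  apply ln_exp.
Qed.

(** On the reals [log x - log lam] is increasing and fixes [beta], and the modulus dominates the
    real part; so every branch maps the half-plane [Re >= beta] into itself. *)
Lemma Re_clog_ge lam beta c p : 0 < lam -> lam * exp beta = beta -> 1 < beta ->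
  beta <= Re p -> beta <= Re (clog lam c p).
Proof.
  intros hl hb h1 hp; rewrite Re_clog.
  rewrite <- (ln_exp beta) at 1; apply ln_le; [apply exp_pos|].
  pose proof (Re_le_cnorm p); apply Rle_div_r; lra.
Qed.

Lemma Rle_of_sqr_mult b d e : 0 <= d -> 0 <= e -> b * (d * d) <= e * d -> b * d <= e.
Proof. intros hd he h; destruct (Rle_lt_or_eq_dec 0 d hd); [nra | subst; lra]. Qed.

(* The derivative of [t |-> <u, log (p + t (q - p))>] with [u = log q - log p]
   is at most [|u| |q - p| / |p + t (q - p)|], by the Cauchy-Schwarz inequality. *)
Lemma clog_contract lam beta c p q : 0 < lam -> 0 < beta ->
  beta <= Re p -> beta <= Re q ->
  beta * cdist (clog lam c q) (clog lam c p) <= cdist q p.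
Proof.
  intros hl hb hp hq.
  set (u1 := Re (clog lam c q) - Re (clog lam c p)).
  set (u2 := Im (clog lam c q) - Im (clog lam c p)).
  set (a := Re q - Re p); set (b := Im q - Im p).
  set (X := fun t => Re p + t * a); set (Y := fun t => Im p + t * b).
  set (f := fun t => u1 * (/2 * ln (X t * X t + Y t * Y t)) + u2 * atan (Y t / X t)).
  set (df := fun t => (u1 * (X t * a + Y t * b) + u2 * (b * X t - a * Y t)) /
                       (X t * X t + Y t * Y t)).
  assert (hX : forall t, 0 <= t <= 1 -> beta <= X t).
  { intros t ht; unfold X, a.
    replace (Re p + t * (Re q - Re p)) with ((1 - t) * Re p + t * Re q) by ring.
    assert (0 <= (1 - t) * (Re p - beta)) by (apply Rmult_le_pos; lra).
    assert (0 <= t * (Re q - beta)) by (apply Rmult_le_pos; lra). lra. }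
  assert (hd : forall t, 0 <= t <= 1 -> is_derive f t (df t)).
  { intros t ht; specialize (hX t ht).
    assert (0 < X t * X t + Y t * Y t) by nra.
    unfold f, df; unfold X, Y in *; auto_derive.
    - repeat split; try lra; auto.
    - unfold Rsqr; field; repeat split; try lra; nra. }
  destruct (MVT_gen f 0 1 df) as [t [ht hm]].
  { intros t; rewrite Rmin_left, Rmax_right by lra; intros ht; apply hd; lra. }
  { intros t; rewrite Rmin_left, Rmax_right by lra; intros ht.
    apply derivable_continuous_pt; exists (df t); apply is_derive_Reals; apply hd; lra. }
  rewrite Rmin_left, Rmax_right in ht by lra.
  assert (hln : forall w, 0 < Re w ->
            Re (clog lam c w) = /2 * ln (Re w * Re w + Im w * Im w) - ln lam).
  { intros w hw; pose proof (Re_le_cnorm w).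
    unfold clog, Re at 1; simpl; rewrite ln_div by lra; f_equal.
    replace (Re w * Re w + Im w * Im w) with (cnorm w * cnorm w)
      by (rewrite cnorm_sqr; ring).
    rewrite ln_mult by lra; lra. }
  assert (hf : f 1 - f 0 = u1 * u1 + u2 * u2).
  { assert (e : f 1 - f 0 = u1 * ((/2 * ln (Re q * Re q + Im q * Im q) - ln lam)
        - (/2 * ln (Re p * Re p + Im p * Im p) - ln lam))
        + u2 * ((c + carg q) - (c + carg p))).
    { unfold f, X, Y, a, b, carg.
      replace (Re p + 1 * (Re q - Re p)) with (Re q) by ring.
      replace (Im p + 1 * (Im q - Im p)) with (Im q) by ring.
      rewrite !Rmult_0_l, !Rplus_0_r; ring. }
    rewrite e, <- !hln by lra; reflexivity. }
  specialize (hX t ht).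
  set (N := sqrt (X t * X t + Y t * Y t)).
  assert (hN2 : N * N = X t * X t + Y t * Y t) by (apply sqrt_sqrt; nra).
  assert (hN : beta <= N).
  { assert (0 <= N) by apply sqrt_pos; nra. }
  pose proof (cdist_pos (clog lam c q) (clog lam c p)) as hD.
  pose proof (cdist_pos q p) as hG.
  pose proof (cdist_sqr (clog lam c q) (clog lam c p)) as hD2; fold u1 u2 in hD2.
  pose proof (cdist_sqr q p) as hG2; fold a b in hG2.
  set (D := cdist (clog lam c q) (clog lam c p)) in *.
  set (G := cdist q p) in *.
  set (num := u1 * (X t * a + Y t * b) + u2 * (b * X t - a * Y t)).
  assert (hnum : num * num <= (D * G * N) * (D * G * N)).
  { replace ((D * G * N) * (D * G * N)) with ((D * D) * (G * G) * (N * N)) by ring.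
    rewrite hD2, hG2, hN2.
    (* Lagrange's identity: the two sides of the Cauchy-Schwarz inequality differ by this square. *)
    pose proof (Rle_0_sqr (u1 * (b * X t - a * Y t) - u2 * (X t * a + Y t * b))) as hs.
    unfold Rsqr in hs; unfold num.
    match goal with |- ?l <= ?r => assert (r - l =
      (u1 * (b * X t - a * Y t) - u2 * (X t * a + Y t * b)) *
      (u1 * (b * X t - a * Y t) - u2 * (X t * a + Y t * b))) by ring end.
    lra. }
  assert (hnum' : num <= D * G * N).
  { assert (0 <= D * G * N) by (repeat apply Rmult_le_pos; lra). nra. }
  assert (hdf : df t * (N * N) = num).
  { unfold df, num; rewrite hN2; field; nra. }
  assert (hDD : D * D = df t) by (rewrite hD2; lra).
  assert (D * D * N <= D * G).
  { apply (Rmult_le_reg_r N); [lra|]. rewrite hDD; lra. }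
  apply Rle_of_sqr_mult; auto.
  assert (0 <= D * D) by nra. nra.
Qed.

(** * Continuity of the iterates *)

Lemma continuous_cdist (f : Cx -> Cx) z :
  continuous (fun w : R * R => Re (f w)) z ->
  continuous (fun w : R * R => Im (f w)) z ->
  forall eps, 0 < eps -> exists d, 0 < d /\
    forall w, cdist w z < d -> cdist (f w) (f z) < eps.
Proof.
  intros h1 h2 eps heps.
  assert (he : 0 < eps / 2) by lra.
  destruct (h1 _ (locally_ball (Re (f z)) (mkposreal _ he))) as [d1 hd1].
  destruct (h2 _ (locally_ball (Im (f z)) (mkposreal _ he))) as [d2 hd2].
  exists (Rmin d1 d2); split; [apply Rmin_pos; apply cond_pos|].
  intros w hw.
  pose proof (Rmin_l d1 d2); pose proof (Rmin_r d1 d2).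
  pose proof (Rabs_Re_le_cdist w z); pose proof (Rabs_Im_le_cdist w z).
  assert (b1 : Rabs (Re (f w) - Re (f z)) < eps / 2).
  { apply (hd1 w); split; unfold ball; simpl; unfold AbsRing_ball, abs, minus, plus, opp;
      simpl; [change (Rabs (Re w - Re z) < d1) | change (Rabs (Im w - Im z) < d1)]; lra. }
  assert (b2 : Rabs (Im (f w) - Im (f z)) < eps / 2).
  { apply (hd2 w); split; unfold ball; simpl; unfold AbsRing_ball, abs, minus, plus, opp;
      simpl; [change (Rabs (Re w - Re z) < d2) | change (Rabs (Im w - Im z) < d2)]; lra. }
  pose proof (cdist_le (f w) (f z)); lra.
Qed.

Lemma Efun_continuous lam z eps : 0 < eps ->
  exists d, 0 < d /\ forall w, cdist w z < d -> cdist (Efun lam w) (Efun lam z) < eps.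
Proof.
  revert eps; apply continuous_cdist; unfold Efun, cexp, Re, Im; simpl.
  - apply (continuous_scal_r lam (fun w : R * R => exp (fst w) * cos (snd w))).
    apply (continuous_mult (fun w : R * R => exp (fst w)) (fun w => cos (snd w))).
    + apply (continuous_comp fst exp); [apply continuous_fst | apply continuous_exp].
    + apply (continuous_comp snd cos); [apply continuous_snd | apply continuous_cos].
  - apply (continuous_scal_r lam (fun w : R * R => exp (fst w) * sin (snd w))).
    apply (continuous_mult (fun w : R * R => exp (fst w)) (fun w => sin (snd w))).
    + apply (continuous_comp fst exp); [apply continuous_fst | apply continuous_exp].
    + apply (continuous_comp snd sin); [apply continuous_snd | apply continuous_sin].
Qed.

Lemma Eiter_continuous lam n z eps : 0 < eps ->
  exists d, 0 < d /\ forall w, cdist w z < d -> cdist (Eiter lam n w) (Eiter lam n z) < eps.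
Proof.
  revert eps; induction n as [|n IH]; intros eps he; simpl.
  - exists eps; auto.
  - destruct (Efun_continuous lam (Eiter lam n z) eps he) as [d [hd h]].
    destruct (IH d hd) as [d' [hd' h']].
    exists d'; split; auto.
Qed.

Lemma Eiter_plus lam m n z : Eiter lam m (Eiter lam n z) = Eiter lam (m + n) z.
Proof. induction m; simpl; congruence. Qed.

Lemma Eiter_S lam n z : Eiter lam (S n) z = Eiter lam n (Efun lam z).
Proof. change (Efun lam z) with (Eiter lam 1 z); rewrite Eiter_plus; f_equal; lia. Qed.

Local Arguments Re : simpl never.
Local Arguments Im : simpl never.
Local Arguments Efun : simpl never.
Local Arguments clog : simpl never.

(** * Elementary estimates, strips and geometric decay *)

Lemma double_le_sinh k : 0 <= k -> 2 * k <= exp k - exp (- k).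
Proof.
  intros hk.
  destruct (MVT_gen (fun t => exp t - exp (- t) - 2 * t) 0 k
              (fun t => exp t + exp (- t) - 2)) as [t [_ ht]].
  { intros t _; auto_derive; auto; ring. }
  { intros t _; apply derivable_continuous_pt; exists (exp t + exp (- t) - 2).
    apply is_derive_Reals; auto_derive; auto; ring. }
  rewrite Ropp_0, exp_0 in ht.
  assert (0 <= exp t + exp (- t) - 2).
  { pose proof (exp_ineq1_le t); pose proof (exp_ineq1_le (- t)); lra. }
  nra.
Qed.

Lemma one_minus_cos_le y : 2 * (1 - cos y) <= y ^ 2.
Proof.
  assert (h : forall t, 0 <= t -> Rabs (sin t) <= t).
  { intros t [ht | <-]; [|rewrite sin_0, Rabs_R0; lra].
    apply Rabs_le; split; [|left; apply sin_lt_x; auto].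
    destruct (Rle_dec t PI).
    - pose proof (sin_ge_0 t); lra.
    - pose proof (SIN_bound t); pose proof PI2_1; lra. }
  replace (cos y) with (cos (2 * (y / 2))) by (f_equal; field).
  rewrite cos_2a_sin.
  assert (h' : Rabs (sin (y / 2)) <= Rabs (y / 2)).
  { destruct (Rle_dec 0 (y / 2)).
    - rewrite (Rabs_pos_eq (y / 2)) by auto; auto.
    - rewrite <- Rabs_Ropp, <- sin_neg, <- (Rabs_Ropp (y / 2)).
      rewrite (Rabs_pos_eq (- (y / 2))) by lra; apply h; lra. }
  apply Rsqr_le_abs_1 in h'; unfold Rsqr in h'; nra.
Qed.

Lemma strip_exists y : exists s : Z, (2 * IZR s - 1) * PI <= y < (2 * IZR s + 1) * PI.
Proof.
  pose proof PI_RGT_0.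
  (* [up] is the least integer strictly above its argument, so subtracting 1 gives the floor. *)
  exists (up ((y + PI) / (2 * PI)) - 1)%Z; rewrite minus_IZR.
  destruct (archimed ((y + PI) / (2 * PI))) as [h1 h2].
  set (m := IZR (up _)) in *.
  assert (e : (y + PI) / (2 * PI) * (2 * PI) = y + PI) by (field; lra).
  split; nra.
Qed.

Lemma multiple_of_2PI t : cos t = 1 -> sin t = 0 -> exists k : Z, t = 2 * IZR k * PI.
Proof.
  intros hc hs; destruct (sin_eq_0_0 t hs) as [k ->].
  destruct (Z.Even_or_Odd k) as [[m ->] | [m ->]].
  - exists m; rewrite mult_IZR; ring.
  - exfalso; rewrite plus_IZR, mult_IZR in hc.
    replace ((2 * IZR m + 1) * PI) with (2 * (IZR m * PI) + PI) in hc by ring.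
    rewrite neg_cos, cos_2a_sin, (sin_eq_0_1 (IZR m * PI)) in hc by (exists m; auto); lra.
Qed.

(** The strip of index [k] is centred at [2 k PI] and has half-width [PI], more than the offset [a].
    This ties itineraries to branches of the logarithm. *)
Lemma in_strip_turn s k (w : Cx) a :
  Im w = 2 * IZR k * PI + a -> - PI / 2 < a < PI / 2 -> (in_strip s w <-> s = k).
Proof.
  intros hw ha; unfold in_strip; rewrite hw; pose proof PI_RGT_0; split.
  - intros [h1 h2].
    assert (IZR s < IZR (k + 1)) by (rewrite plus_IZR; nra).
    assert (IZR k < IZR (s + 1)) by (rewrite plus_IZR; nra).
    apply lt_IZR in H0, H1; lia.
  - intros ->; split; nra.
Qed.

Lemma strictly_incr_ge f : strictly_incr f -> forall n, (n <= f n)%nat.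
Proof. intros h n; induction n; [lia | specialize (h n); lia]. Qed.

Lemma pow_mult_lt q K e : 0 <= q < 1 -> 0 < e ->
  exists N, forall n, (N <= n)%nat -> q ^ n * K < e.
Proof.
  intros hq he.
  assert (hk : 0 < e / (Rabs K + 1)).
  { apply Rdiv_lt_0_compat; auto; pose proof (Rabs_pos K); lra. }
  destruct (pow_lt_1_zero q) with (y := e / (Rabs K + 1)) as [N hN]; auto.
  { rewrite Rabs_pos_eq; lra. }
  exists N; intros n hn; specialize (hN n hn).
  pose proof (pow_le q n (proj1 hq)) as hp; rewrite Rabs_pos_eq in hN by auto.
  pose proof (Rle_abs K); pose proof (Rabs_pos K).
  apply Rle_lt_trans with (q ^ n * (Rabs K + 1)); [nra|].
  apply (Rmult_lt_compat_r (Rabs K + 1)) in hN; [|lra].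
  replace (e / (Rabs K + 1) * (Rabs K + 1)) with e in hN by (field; lra); lra.
Qed.

Section Dynamics.

Variables lam beta : R.
Hypotheses (lam_pos : 0 < lam) (lam_lt : lam < exp (-1))
  (beta_fix : lam * exp beta = beta) (beta_gt_1 : 1 < beta).

(** * The real map [lam * exp] and contraction towards its attracting fixed point *)

Lemma Ereal_tangent a b : lam * exp a * (b - a) <= lam * exp b - lam * exp a.
Proof.
  replace (exp b) with (exp a * exp (b - a)) by (rewrite <- exp_plus; f_equal; ring).
  pose proof (exp_ineq1_le (b - a)); pose proof (exp_pos a).
  assert (0 < lam * exp a) by nra. nra.
Qed.

(** Both chords are compared with the tangent at [b]. The product form also covers degenerate
    intervals. *)
Lemma Ereal_chord a b c : a <= b -> b <= c ->
  (lam * exp b - lam * exp a) * (c - b) <= (lam * exp c - lam * exp b) * (b - a).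
Proof.
  intros h1 h2; pose proof (Ereal_tangent b a); pose proof (Ereal_tangent b c).
  apply Rle_trans with (lam * exp b * (b - a) * (c - b)).
  - apply Rmult_le_compat_r; lra.
  - replace (_ * (b - a) * (c - b)) with (lam * exp b * (c - b) * (b - a)) by ring.
    apply Rmult_le_compat_r; lra.
Qed.

Lemma Ereal_le a b : a <= b -> lam * exp a <= lam * exp b.
Proof.
  intros h; apply Rmult_le_compat_l; [lra|].
  destruct h as [h | ->]; [left; apply exp_increasing; auto | lra].
Qed.

Lemma Ereal_expand a b : beta <= a -> a <= b ->
  beta * (b - a) <= lam * exp b - lam * exp a.
Proof.
  intros h1 h2; pose proof (Ereal_tangent a b); pose proof (Ereal_le _ _ h1); nra.
Qed.

Lemma lam_exp_1 : lam * exp 1 < 1.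
Proof.
  replace 1 with (exp (-1) * exp 1) at 2.
  - apply Rmult_lt_compat_r; [apply exp_pos | auto].
  - rewrite <- exp_plus; replace (-1 + 1) with 0 by ring; apply exp_0.
Qed.

Lemma attracting_fixpoint : exists alpha, 0 < alpha < 1 /\ lam * exp alpha = alpha.
Proof.
  destruct (IVT (fun x => x - lam * exp x) 0 1) as [a [ha he]].
  - intros x; apply derivable_continuous_pt; exists (1 - lam * exp x).
    apply is_derive_Reals; auto_derive; auto; ring.
  - lra.
  - rewrite exp_0; lra.
  - pose proof lam_exp_1; lra.
  - pose proof lam_exp_1; pose proof (exp_pos a).
    assert (0 < lam * exp a) by nra.
    exists a; repeat split; try lra.
    destruct (Req_dec a 1) as [-> | ]; lra.
Qed.

(* The contraction rate is the slope of the chord of [E] over [[alpha, x]]. *)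
Lemma half_plane_contract alpha x : 0 < alpha -> lam * exp alpha = alpha ->
  alpha < x < beta ->
  exists s, 0 <= s < 1 /\ lam * exp x <= x /\ forall w, Re w <= x ->
    cdist (Efun lam w) (alpha, 0) <= s * cdist w (alpha, 0).
Proof.
  intros ha0 ha [hx1 hx2].
  set (h := x - alpha).
  assert (hEx : lam * exp x = alpha * exp h).
  { rewrite <- ha; unfold h.
    rewrite Rmult_assoc, <- exp_plus; do 2 f_equal; ring. }
  set (s := (lam * exp x - alpha) / h).
  assert (hh : 0 < h) by (unfold h; lra).
  assert (hs : s * h = lam * exp x - alpha) by (unfold s; field; lra).
  (* By convexity the graph lies below its chord from [alpha] to [beta], which is the diagonal. Were
     [x] a third fixed point, the slope there would be [x], and the strict tangent inequality would
     give [x > 1] towards [alpha] and [x < 1] towards [beta]. *)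
  assert (hx : lam * exp x < x).
  { pose proof (Ereal_chord alpha x beta ltac:(lra) ltac:(lra)) as hc.
    rewrite ha, beta_fix in hc.
    assert (hle : lam * exp x <= x) by nra.
    destruct hle as [ | he]; auto; exfalso.
    pose proof (exp_ineq1 (alpha - x) ltac:(lra)).
    pose proof (exp_ineq1 (beta - x) ltac:(lra)).
    assert (e : forall t, x * exp (t - x) = lam * exp t).
    { intros t; rewrite <- he at 1; rewrite Rmult_assoc, <- exp_plus; do 2 f_equal; ring. }
    pose proof (e alpha) as e1; pose proof (e beta) as e2.
    rewrite ha in e1; rewrite beta_fix in e2.
    nra. }
  assert (hmono : alpha <= lam * exp x) by (rewrite <- ha; apply Ereal_le; lra).
  assert (hs0 : 0 <= s) by (unfold s; apply Rdiv_le_0_compat; lra).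
  assert (hs1 : s < 1).
  { apply (Rmult_lt_reg_r h); auto; unfold h in *; lra. }
  assert (hsa : alpha <= s).
  { apply (Rmult_le_reg_r h); auto.
    pose proof (Ereal_tangent alpha x); rewrite ha in *; unfold h in *; lra. }
  (* [s] is the logarithmic mean of [alpha] and [lam * exp x], hence at least their geometric
     mean. *)
  assert (hss : alpha * (lam * exp x) <= s * s).
  { pose proof (double_le_sinh (h / 2) ltac:(lra)) as hk.
    assert (eg : exp h = exp (h / 2) * exp (h / 2)) by (rewrite <- exp_plus; f_equal; field).
    assert (e1 : exp (h / 2) * exp (- (h / 2)) = 1).
    { rewrite <- exp_plus; replace (h / 2 + - (h / 2)) with 0 by ring; apply exp_0. }
    pose proof (exp_pos (h / 2)) as hg; set (g := exp (h / 2)) in *.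
    assert (hgh : g * h <= g * g - 1) by nra.
    apply (Rmult_le_reg_r (h * h)); [nra|].
    replace (s * s * (h * h)) with ((s * h) * (s * h)) by ring.
    rewrite hs, hEx, eg.
    replace (alpha * (alpha * (g * g)) * (h * h)) with ((alpha * alpha) * ((g * h) * (g * h))) by ring.
    replace ((alpha * (g * g) - alpha) * (alpha * (g * g) - alpha))
      with ((alpha * alpha) * ((g * g - 1) * (g * g - 1))) by ring.
    apply Rmult_le_compat_l; [nra|].
    assert (0 <= g * h) by nra. nra. }
  exists s; repeat split; auto; [lra|].
  intros w hw.
  set (u := Re w) in *.
  (* In the real direction: right of [alpha] chord slopes from [alpha] increase up to [s]; left of
     it they are at most the slope [alpha <= s]. *)
  assert (hu : (lam * exp u - alpha) * (lam * exp u - alpha) <= s * s * ((u - alpha) * (u - alpha))).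
  { assert (hab : Rabs (lam * exp u - alpha) <= s * Rabs (u - alpha)).
    { destruct (Rle_dec alpha u) as [h1 | h1].
      - pose proof (Ereal_le _ _ h1) as h2; rewrite ha in h2.
        rewrite !Rabs_pos_eq by lra.
        pose proof (Ereal_chord alpha u x h1 hw) as hc; rewrite ha in hc.
        apply (Rmult_le_reg_r h); auto.
        replace (s * (u - alpha) * h) with ((s * h) * (u - alpha)) by ring.
        rewrite hs; unfold h; lra.
      - pose proof (Ereal_le u alpha ltac:(lra)) as h2; rewrite ha in h2.
        rewrite !Rabs_left1 by lra.
        pose proof (Ereal_tangent alpha u) as h3; rewrite ha in h3. nra. }
    pose proof (Rabs_pos (lam * exp u - alpha)); pose proof (Rabs_pos (u - alpha)).
    assert (hsq : forall t, t * t = Rabs t * Rabs t).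
    { intros t; rewrite <- Rabs_mult, Rabs_pos_eq; nra. }
    rewrite (hsq (lam * exp u - alpha)), (hsq (u - alpha)).
    replace (s * s * (Rabs (u - alpha) * Rabs (u - alpha)))
      with ((s * Rabs (u - alpha)) * (s * Rabs (u - alpha))) by ring.
    apply Rmult_le_compat; auto. }
  pose proof (cdist_pos (Efun lam w) (alpha, 0)); pose proof (cdist_pos w (alpha, 0)).
  assert (0 <= s * cdist w (alpha, 0)) by (apply Rmult_le_pos; auto).
  apply Rsqr_incr_0; auto; unfold Rsqr.
  replace (s * cdist w (alpha, 0) * (s * cdist w (alpha, 0)))
    with (s * s * (cdist w (alpha, 0) * cdist w (alpha, 0))) by ring.
  rewrite !cdist_sqr, Re_Efun, Im_Efun; fold u.
  change (Re (alpha, 0)) with alpha; change (Im (alpha, 0)) with 0.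
  pose proof (one_minus_cos_le (Im w)) as hcos; pose proof (COS_bound (Im w)).
  pose proof (sin2_cos2 (Im w)) as hsc; unfold Rsqr in hsc.
  set (y := Im w) in *; set (e := lam * exp u) in *.
  assert (hle : e <= lam * exp x) by (apply Ereal_le; auto).
  assert (he : 0 < e) by (apply Rmult_lt_0_compat; [auto | apply exp_pos]).
  (* The squared distance equals [(e - alpha)^2 + 2 alpha e (1 - cos y)]; [hu] bounds the first
     term, [hss] together with [hcos] the second. *)
  replace ((e * cos y - alpha) ^ 2 + (e * sin y - 0) ^ 2)
    with (e * e * (sin y * sin y + cos y * cos y) - 2 * alpha * e * cos y + alpha * alpha) by ring.
  rewrite hsc.
  assert (alpha * e * (2 * (1 - cos y)) <= s * s * y ^ 2).
  { apply Rmult_le_compat; try lra; [nra|].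
    apply Rle_trans with (alpha * (lam * exp x)); auto; apply Rmult_le_compat_l; lra. }
  nra.
Qed.

(** * The Julia set as the set of points whose orbits stay in [Re >= beta] *)

Lemma Re_Efun_le w : Re (Efun lam w) <= lam * exp (Re w).
Proof. rewrite <- cnorm_Efun by auto; apply Re_le_cnorm. Qed.

(** By continuity [E^m] carries a disc about [z] into a half-plane [Re <= x] with [x < beta]. [E]
    maps that half-plane into itself and contracts it towards [alpha], so the iterates converge
    uniformly on the disc. *)
Lemma in_Fatou_of_Re_lt z m : Re (Eiter lam m z) < beta -> in_Fatou lam z.
Proof.
  intros hm; destruct attracting_fixpoint as [alpha [[ha0 ha1] ha]].
  (* Above both [alpha] and the real part reached, and still below [beta]. *)
  set (x := Rmax ((alpha + beta) / 2) ((Re (Eiter lam m z) + beta) / 2)).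
  pose proof (Rmax_l ((alpha + beta) / 2) ((Re (Eiter lam m z) + beta) / 2)) as hx1.
  pose proof (Rmax_r ((alpha + beta) / 2) ((Re (Eiter lam m z) + beta) / 2)) as hx2.
  fold x in hx1, hx2.
  assert (hx3 : x < beta) by (apply Rmax_lub_lt; lra).
  destruct (half_plane_contract alpha x) as [s [hs [hx hc]]]; auto; [lra|].
  destruct (Eiter_continuous lam m z (x - Re (Eiter lam m z)) ltac:(lra)) as [r [hr hd]].
  set (K := (x - Re (Eiter lam m z)) + cdist (Eiter lam m z) (alpha, 0)).
  assert (hit : forall n w, cdist w z < r ->
    Re (Eiter lam (n + m) w) <= x /\ cdist (Eiter lam (n + m) w) (alpha, 0) <= s ^ n * K).
  { intros n w hw; specialize (hd w hw); induction n as [|n [IH1 IH2]].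
    - simpl; split.
      + pose proof (Rabs_Re_le_cdist (Eiter lam m w) (Eiter lam m z)) as h.
        apply Rabs_le_between in h; lra.
      + pose proof (cdist_triangle (Eiter lam m w) (Eiter lam m z) (alpha, 0)); unfold K; lra.
    - change (Eiter lam (S n + m) w) with (Efun lam (Eiter lam (n + m) w)); split.
      + pose proof (Re_Efun_le (Eiter lam (n + m) w)); pose proof (Ereal_le _ _ IH1); lra.
      + specialize (hc _ IH1); simpl; nra. }
  exists r; split; auto; intros phi hphi.
  exists (fun k => k); split; [intros k; lia|].
  left; exists (fun _ => (alpha, 0)); intros t ht eps heps.
  destruct (pow_mult_lt s K eps hs heps) as [N hN].
  exists (N + m)%nat; intros k w hk hw.
  pose proof (strictly_incr_ge phi hphi k).
  replace (phi k) with ((phi k - m) + m)%nat by lia.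
  apply Rle_lt_trans with (s ^ (phi k - m) * K); [apply hit; lra | apply hN; lia].
Qed.

Definition good (w : Cx) : Prop := forall n, beta <= Re (Eiter lam n w).

Lemma good_of_Julia z : in_Julia lam z -> good z.
Proof.
  intros hz n; apply Rnot_lt_le; intros h; apply hz; eapply in_Fatou_of_Re_lt; eauto.
Qed.

(* The multiple of [2 PI] selecting the branch of the logarithm that sends
   [E^(n+1)(w)] back to [E^n(w)]. *)
Definition turn (w : Cx) (n : nat) : R :=
  Im (Eiter lam n w) - carg (Eiter lam (S n) w).

Lemma turn_trig w n : good w -> cos (turn w n) = 1 /\ sin (turn w n) = 0.
Proof.
  intros h; apply (phase_trig lam (Eiter lam n w)); auto.
  apply Rlt_le_trans with beta; [lra | apply (h (S n))].
Qed.

Lemma clog_turn w n : clog lam (turn w n) (Eiter lam (S n) w) = Eiter lam n w.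
Proof. apply clog_Efun; auto. Qed.

(** Takes a point at time [j + m] back to time [j] through the branches [c j], ..., [c (j + m - 1)],
    the last one being applied first. *)
Fixpoint pull (c : nat -> R) (j m : nat) (p : Cx) : Cx :=
  match m with O => p | S k => clog lam (c j) (pull c (S j) k p) end.

Lemma Re_pull_ge c j m p : beta <= Re p -> beta <= Re (pull c j m p).
Proof.
  intros hp; revert j; induction m as [|m IH]; intros j; simpl; auto.
  apply (Re_clog_ge lam beta); auto.
Qed.

Lemma pull_contract c j m p q : beta <= Re p -> beta <= Re q ->
  cdist (pull c j m q) (pull c j m p) <= (/ beta) ^ m * cdist q p.
Proof.
  intros hp hq; revert j; induction m as [|m IH]; intros j; simpl; [lra|].
  pose proof (clog_contract lam beta (c j) (pull c (S j) m p) (pull c (S j) m q) lam_pos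
    ltac:(lra) (Re_pull_ge c _ m p hp) (Re_pull_ge c _ m q hq)) as h.
  specialize (IH (S j)).
  apply (Rmult_le_reg_l beta); [lra|].
  replace (beta * (/ beta * (/ beta) ^ m * cdist q p)) with ((/ beta) ^ m * cdist q p)
    by (field; lra).
  lra.
Qed.

Lemma Eiter_pull c j i m p : (forall n, cos (c n) = 1 /\ sin (c n) = 0) ->
  beta <= Re p -> Eiter lam i (pull c j (i + m) p) = pull c (i + j) m p.
Proof.
  intros hc hp; revert j; induction i as [|i IH]; intros j; simpl pull; auto.
  rewrite Eiter_S, Efun_clog; [| | apply hc | apply hc |]; auto.
  - rewrite IH; f_equal; lia.
  - pose proof (Re_pull_ge c (S j) (i + m) p hp); lra.
Qed.

Lemma pull_orbit c w j m : (forall n, turn w n = c n) ->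
  pull c j m (Eiter lam (j + m) w) = Eiter lam j w.
Proof.
  intros hc; revert j; induction m as [|m IH]; intros j; simpl.
  - f_equal; lia.
  - replace (j + S m)%nat with (S j + m)%nat by lia.
    rewrite IH, <- hc; apply clog_turn.
Qed.

(** The definition peels off the outermost branch; passing from [m] to [m + 1] in a limit needs the
    innermost one. *)
Lemma pull_S c j m p : pull c j (S m) p = pull c j m (clog lam (c (j + m)%nat) p).
Proof.
  revert j; induction m as [|m IH]; intros j.
  - rewrite Nat.add_0_r; reflexivity.
  - replace (j + S m)%nat with (S j + m)%nat by lia.
    change (pull c j (S (S m)) p) with (clog lam (c j) (pull c (S j) (S m) p)).
    rewrite IH; reflexivity.
Qed.

Lemma inv_beta_pow m : 0 < (/ beta) ^ m.
Proof. apply pow_lt, Rinv_0_lt_compat; lra. Qed.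

Lemma inv_beta_lt_1 : 0 <= / beta < 1.
Proof.
  split; [left; apply Rinv_0_lt_compat; lra|].
  rewrite <- Rinv_1; apply Rinv_lt_contravar; lra.
Qed.

(* Pulling an odd multiple of [PI * i] near [E^n(z)] back along the orbit of [z]
   gives points arbitrarily close to [z] whose orbits end up in [Re <= 1]. *)
Lemma Julia_of_good z : good z -> in_Julia lam z.
Proof.
  intros hz [r [hr hF]].
  (* At time [n] the orbit of [w] hits the negative real axis, possibly with large modulus; from
     then on it stays in the unit disc. Hence the two alternatives. *)
  assert (hlow : forall d, 0 < d -> exists w n, cdist w z < d /\
             forall m, (n <= m)%nat -> cnorm (Eiter lam m w) <= 1 \/ Re (Eiter lam m w) <= 1 /\ m = n).
  { intros d hd.
    destruct (pow_mult_lt (/ beta) (2 * PI) d inv_beta_lt_1 hd) as [n hn].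
    specialize (hn n (Nat.le_refl n)).
    destruct (strip_exists (Im (Eiter lam n z))) as [s hs].
    set (p := (Re (Eiter lam n z), (2 * IZR s + 1) * PI)).
    assert (hp : beta <= Re p) by apply (hz n).
    exists (pull (turn z) 0 n p), (S n); split.
    - eapply Rle_lt_trans; [|exact hn].
      pose proof (pull_orbit (turn z) z 0 n (fun _ => eq_refl)) as ho; simpl in ho.
      rewrite <- ho at 2.
      eapply Rle_trans; [apply pull_contract; auto; apply (hz n)|].
      apply Rmult_le_compat_l; [left; apply inv_beta_pow|].
      pose proof (cdist_le p (Eiter lam n z)) as hc.
      unfold p in hc at 2 3; unfold Re at 1, Im at 1 in hc; simpl in hc.
      rewrite Rminus_diag, Rabs_R0, Rabs_pos_eq in hc; lra.
    - assert (hpn : Eiter lam n (pull (turn z) 0 n p) = p).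
      { rewrite <- (Nat.add_0_r n) at 2.
        rewrite Eiter_pull; auto; intros; apply turn_trig; auto. }
      assert (h0 : Re (Eiter lam (S n) (pull (turn z) 0 n p)) <= 1).
      { simpl; rewrite hpn, Re_Efun.
        replace (Im p) with (2 * (IZR s * PI) + PI) by (unfold p, Im; simpl; ring).
        rewrite neg_cos, cos_2a_sin, (sin_eq_0_1 (IZR s * PI)) by (exists s; auto).
        pose proof (exp_pos (Re p)); nra. }
      assert (hstep : forall v, Re v <= 1 -> cnorm (Efun lam v) <= 1).
      { intros v hv; rewrite cnorm_Efun by auto.
        pose proof (Ereal_le _ _ hv); pose proof lam_exp_1; lra. }
      intros m hm; destruct (Nat.eq_dec m (S n)) as [-> | hne]; [right; auto | left].
      replace m with ((m - S (S n)) + S (S n))%nat by lia.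
      induction (m - S (S n))%nat as [|i IH].
      + apply hstep; auto.
      + apply hstep; eapply Rle_trans; [apply Re_le_cnorm | exact IH]. }
  destruct (hF (fun k => k)) as [psi [hpsi hlim]]; [intros k; lia|].
  pose proof (strictly_incr_ge psi hpsi) as hge.
  destruct hlim as [[g hg] | hinf].
  (* A finite limit: [E^(psi N)(w)] has real part at least [beta - e], a later iterate has real part
     at most 1, and both are within [e] of [g w]. The gap [4 e] exceeds the total error [3 e]. *)
  - set (e := (beta - 1) / 4).
    destruct (hg (r / 2) ltac:(lra) e ltac:(unfold e; lra)) as [N hN].
    destruct (Eiter_continuous lam (psi N) z e ltac:(unfold e; lra)) as [d [hd hc]].
    destruct (hlow (Rmin d (r / 2))) as [w [n [hw hlo]]]; [apply Rmin_pos; lra|].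
    pose proof (Rmin_l d (r / 2)); pose proof (Rmin_r d (r / 2)).
    specialize (hc w ltac:(lra)).
    pose proof (hN N w (Nat.le_refl N) ltac:(lra)) as h1.
    pose proof (hN (N + n)%nat w ltac:(lia) ltac:(lra)) as h2.
    assert (h3 : Re (Eiter lam (psi (N + n)%nat) w) <= 1).
    { specialize (hge (N + n)%nat).
      destruct (hlo (psi (N + n)%nat) ltac:(lia)) as [h | [h _]]; auto.
      eapply Rle_trans; [apply Re_le_cnorm | exact h]. }
    pose proof (hz (psi N)).
    pose proof (Rabs_Re_le_cdist (Eiter lam (psi N) w) (Eiter lam (psi N) z)) as k1.
    pose proof (Rabs_Re_le_cdist (Eiter lam (psi N) w) (g w)) as k2.
    pose proof (Rabs_Re_le_cdist (Eiter lam (psi (N + n)%nat) w) (g w)) as k3.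
    apply Rabs_le_between in k1, k2, k3; unfold e in *; lra.
  - destruct (hlow (r / 2) ltac:(lra)) as [w [n [hw hlo]]].
    destruct (hinf (r / 2) ltac:(lra) 1) as [N hN].
    (* The index [N + S n] makes [psi] exceed the exceptional time [n], so that the modulus is at
       most 1. *)
    specialize (hN (N + S n)%nat w ltac:(lia) ltac:(lra)).
    specialize (hge (N + S n)%nat).
    destruct (hlo (psi (N + S n)%nat) ltac:(lia)) as [h | [_ h]]; [lra | lia].
Qed.

(** * Hairs and their order *)

Definition on_hair (c : nat -> R) (w : Cx) : Prop :=
  good w /\ forall n, turn w n = c n.

(** Each turn is [2 k PI], and [k] is the itinerary entry because the argument of the next point
    lies within [PI / 2] of 0. Equal itineraries thus mean equal branches, the form that suits
    pulling back. *)
Lemma hair_iff z w : good z -> (hair lam z w <-> on_hair (turn z) w).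
Proof.
  intros hz.
  assert (hk : forall v, good v -> forall n, exists k : Z, turn v n = 2 * IZR k * PI /\
             forall s, in_strip s (Eiter lam n v) <-> s = k).
  { intros v hv n; destruct (turn_trig v n hv) as [hc hs].
    destruct (multiple_of_2PI _ hc hs) as [k hk]; exists k; split; auto; intros s.
    apply in_strip_turn with (a := carg (Eiter lam (S n) v)); [|apply carg_bound].
    rewrite <- hk; unfold turn; ring. }
  split.
  - intros [hJ hi]; apply good_of_Julia in hJ; split; auto; intros n.
    destruct (hk z hz n) as [k [e1 h1]], (hk w hJ n) as [l [e2 h2]].
    rewrite e1, e2; repeat f_equal.
    symmetry; apply h2, hi, h1; auto.
  - intros [hw ht]; split; [apply Julia_of_good; auto|]; intros n s.
    destruct (hk z hz n) as [k [e1 h1]], (hk w hw n) as [l [e2 h2]].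
    rewrite h1, h2; rewrite ht, e1 in e2.
    pose proof PI_RGT_0.
    assert (IZR k = IZR l) by nra.
    apply eq_IZR in H0; subst; tauto.
Qed.

Lemma cnorm_orbit w n : cnorm (Eiter lam (S n) w) = lam * exp (Re (Eiter lam n w)).
Proof. apply cnorm_Efun; auto. Qed.

Lemma good_cnorm_ge w n : good w -> beta <= cnorm (Eiter lam n w).
Proof. intros h; eapply Rle_trans; [apply (h n) | apply Re_le_cnorm]. Qed.

Lemma hair_Im_diff c v w n : on_hair c v -> on_hair c w ->
  Rabs (Im (Eiter lam n w) - Im (Eiter lam n v)) <= PI.
Proof.
  intros [_ hv] [_ hw]; specialize (hv n); specialize (hw n); unfold turn in hv, hw.
  pose proof (carg_bound (Eiter lam (S n) v)); pose proof (carg_bound (Eiter lam (S n) w)).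
  apply Rabs_le; lra.
Qed.

Lemma hair_cdist_le c v w n K : on_hair c v -> on_hair c w ->
  Rabs (Re (Eiter lam n w) - Re (Eiter lam n v)) <= K ->
  cdist (Eiter lam n w) (Eiter lam n v) <= K + PI.
Proof.
  intros hv hw hK; pose proof (hair_Im_diff c v w n hv hw).
  pose proof (cdist_le (Eiter lam n w) (Eiter lam n v)); lra.
Qed.

Lemma hair_expand c v w j m : on_hair c v -> on_hair c w ->
  cdist (Eiter lam j w) (Eiter lam j v) <=
  (/ beta) ^ m * cdist (Eiter lam (j + m) w) (Eiter lam (j + m) v).
Proof.
  intros [hv cv] [hw cw].
  rewrite <- (pull_orbit c w j m cw), <- (pull_orbit c v j m cv) at 1.
  apply pull_contract; auto.
Qed.

(** Pulling the gap at time [n] back to time 0 divides it by at least [beta ^ n]; gaps bounded along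
    arbitrarily late times force the points to coincide. *)
Lemma hair_eq c v w K : on_hair c v -> on_hair c w ->
  (forall N, exists n, (N <= n)%nat /\
     Rabs (Re (Eiter lam n w) - Re (Eiter lam n v)) <= K) -> w = v.
Proof.
  intros hv hw hK; apply cdist_eq, Rle_antisym; [|apply cdist_pos].
  apply le_epsilon; intros e he; rewrite Rplus_0_l.
  destruct (pow_mult_lt (/ beta) (K + PI) e inv_beta_lt_1 he) as [N hN].
  destruct (hK N) as [n [hn hd]]; left; eapply Rle_lt_trans; [|apply (hN n hn)].
  eapply Rle_trans; [apply (hair_expand c v w 0 n hv hw)|].
  apply Rmult_le_compat_l; [left; apply inv_beta_pow|].
  apply (hair_cdist_le c); auto.
Qed.

(* A lead of 6 is large enough to increase forever: it is turned into a ratio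
   of moduli of at least [exp 6], against which the imaginary parts, which differ by at most
   [PI], are negligible. *)
Definition ahead (w v : Cx) : Prop :=
  exists n, 6 <= Re (Eiter lam n w) - Re (Eiter lam n v).

Lemma lead_step c v w n : on_hair c v -> on_hair c w ->
  6 <= Re (Eiter lam n w) - Re (Eiter lam n v) ->
  (Re (Eiter lam n w) - Re (Eiter lam n v)) * cnorm (Eiter lam (S n) v)
     <= Re (Eiter lam (S n) w) /\
  Re (Eiter lam n w) - Re (Eiter lam n v) + 1
     <= Re (Eiter lam (S n) w) - Re (Eiter lam (S n) v).
Proof.
  intros hv hw hD.
  set (D := Re (Eiter lam n w) - Re (Eiter lam n v)) in *.
  (* From [exp D >= (1 + D / 2)^2] and [D >= 6]. *)
  assert (he : D + 7 <= exp D).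
  { replace D with (D / 2 + D / 2) at 2 by field; rewrite exp_plus.
    pose proof (exp_ineq1_le (D / 2)); nra. }
  assert (hn : cnorm (Eiter lam (S n) w) = exp D * cnorm (Eiter lam (S n) v)).
  { rewrite !cnorm_orbit; unfold D.
    replace (exp (Re (Eiter lam n w))) with
      (exp (Re (Eiter lam n w) - Re (Eiter lam n v)) * exp (Re (Eiter lam n v)))
      by (rewrite <- exp_plus; f_equal; ring).
    ring. }
  pose proof (hair_Im_diff c v w (S n) hv hw) as hi.
  pose proof (good_cnorm_ge v (S n) (proj1 hv)).
  pose proof (cnorm_le (Eiter lam (S n) w)) as h1.
  pose proof (Rabs_Im_le_cnorm (Eiter lam (S n) v)) as h2.
  pose proof (Re_le_cnorm (Eiter lam (S n) v)) as h3.
  pose proof (proj1 hw (S n)).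
  rewrite (Rabs_pos_eq (Re _)) in h1 by lra.
  apply Rabs_le_between in h2, hi.
  pose proof PI_4; pose proof PI_RGT_0.
  set (r := cnorm (Eiter lam (S n) v)) in *.
  (* Of the modulus, at least [(D + 7) r], the imaginary part takes at most [r + 4], where 4 bounds
     [PI]; as [r > 1], enough is left for both claims. *)
  assert (h4 : Rabs (Im (Eiter lam (S n) w)) <= r + 4) by (apply Rabs_le; lra).
  assert ((D + 7) * r <= exp D * r) by (apply Rmult_le_compat_r; lra).
  assert (D + 5 <= (D + 5) * r) by nra.
  split; lra.
Qed.

Lemma lead_growth c v w n : on_hair c v -> on_hair c w ->
  6 <= Re (Eiter lam n w) - Re (Eiter lam n v) -> forall j,
  6 + INR j <= Re (Eiter lam (j + n) w) - Re (Eiter lam (j + n) v).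
Proof.
  intros hv hw hD j; induction j as [|j IH]; [simpl; lra|].
  rewrite S_INR; pose proof (pos_INR j).
  destruct (lead_step c v w (j + n) hv hw) as [_ h]; [lra|].
  change (S j + n)%nat with (S (j + n)); lra.
Qed.

(** The lead grows by at least 1 per step, so it passes [A]; one step later [lead_step] turns it
    into a ratio of sizes. *)
Lemma ahead_dominates c v w A : on_hair c v -> on_hair c w -> ahead w v ->
  exists k, forall n, (k <= n)%nat ->
    A * cnorm (Eiter lam n v) <= Re (Eiter lam n w) /\
    A <= Re (Eiter lam n w) - Re (Eiter lam n v).
Proof.
  intros hv hw [n0 hD].
  destruct (INR_unbounded A) as [N hN].
  exists (S (N + n0)); intros [|n] hn; [lia|].
  pose proof (lead_growth c v w n0 hv hw hD (n - n0)) as h.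
  replace (n - n0 + n0)%nat with n in h by lia.
  assert (INR N <= INR (n - n0)) by (apply le_INR; lia).
  pose proof (pos_INR (n - n0)).
  destruct (lead_step c v w n hv hw) as [h1 h2]; [lra|].
  pose proof (cnorm_pos (Eiter lam (S n) v)).
  split; [|lra].
  eapply Rle_trans; [|exact h1]; apply Rmult_le_compat_r; lra.
Qed.

Lemma not_ahead_of_bounded c v w K N : on_hair c v -> on_hair c w ->
  (forall n, (N <= n)%nat -> Re (Eiter lam n w) - Re (Eiter lam n v) <= K) -> ~ ahead w v.
Proof.
  intros hv hw hK ha.
  destruct (ahead_dominates c v w (K + 1) hv hw ha) as [k hk].
  destruct (hk (k + N)%nat ltac:(lia)) as [_ h]; specialize (hK (k + N)%nat ltac:(lia)); lra.
Qed.

(** If neither point leads, the real parts differ by less than 6 at all times, and [hair_eq]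
    applies. *)
Lemma ahead_total c v w : on_hair c v -> on_hair c w -> w <> v -> ahead w v \/ ahead v w.
Proof.
  intros hv hw hne; apply NNPP; intros h; apply hne, (hair_eq c v w 6); auto.
  intros N; exists N; split; auto; apply Rabs_le; split; apply Rnot_lt_le; intros hl; apply h.
  - right; exists N; lra.
  - left; exists N; lra.
Qed.

(** The imaginary part is controlled by the negligible [v], so the modulus of [E^(n+1)(w)] is at
    most [3 / 2] of its real part. Shifting by 1 gains a factor [exp 1 > 2], which pays for this
    loss and for the final [- 1]. So [Re - 1] grows at least as fast as a real orbit. *)
Lemma shifted_growth c v w : on_hair c v -> on_hair c w -> ahead w v ->
  exists k, forall n, (k <= n)%nat ->
    lam * exp (Re (Eiter lam n w) - 1) <= Re (Eiter lam (S n) w) - 1.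
Proof.
  intros hv hw ha; destruct (ahead_dominates c v w 10 hv hw ha) as [k hk].
  exists k; intros n hn; destruct (hk (S n) ltac:(lia)) as [h _].
  pose proof (good_cnorm_ge v (S n) (proj1 hv)).
  pose proof (cnorm_le (Eiter lam (S n) w)) as h1.
  pose proof (Rabs_Im_le_cnorm (Eiter lam (S n) v)) as h2.
  pose proof (hair_Im_diff c v w (S n) hv hw) as hi.
  pose proof (proj1 hw (S n)).
  rewrite (Rabs_pos_eq (Re _)), cnorm_orbit in h1 by lra.
  apply Rabs_le_between in h2, hi; pose proof PI_4.
  assert (h4 : Rabs (Im (Eiter lam (S n) w)) <= cnorm (Eiter lam (S n) v) + 4)
    by (apply Rabs_le; lra).
  set (x := Re (Eiter lam n w)) in *.
  assert (hx : exp x = exp (x - 1) * exp 1) by (rewrite <- exp_plus; f_equal; ring).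
  assert (lam * exp x <= 3 / 2 * Re (Eiter lam (S n) w)) by lra.
  pose proof (exp_ineq1 1 ltac:(lra)); pose proof (exp_pos (x - 1)).
  assert (2 * (lam * exp (x - 1)) <= lam * exp x).
  { rewrite hx; assert (0 < lam * exp (x - 1)) by nra; nra. }
  lra.
Qed.

(** * The linearizer on the nonnegative axis *)

Section Poincare.

(* [F] is the linearizer [S] of the theorem. *)
Variable F : R -> R.
Hypotheses (F_eq : forall t, F (beta * t) = lam * exp (F t)) (F_0 : F 0 = beta)
  (F_deriv : derivable_pt_lim F 0 1) (F_incr : forall s t, s < t -> F s < F t).

Lemma F_mono s t : s <= t -> F s <= F t.
Proof. intros [h | ->]; [left; auto | lra]. Qed.

Lemma F_lt_inv s t : F s < F t -> s < t.
Proof. intros h; apply Rnot_le_lt; intros hl; apply F_mono in hl; lra. Qed.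

Lemma F_ge t : 0 <= t -> beta <= F t.
Proof. intros h; rewrite <- F_0; apply F_mono; auto. Qed.

Lemma beta_pow_pos n : 0 < beta ^ n.
Proof. apply pow_lt; lra. Qed.

Lemma beta_pow_nonneg n t : 0 <= t -> 0 <= beta ^ n * t.
Proof. intros; apply Rmult_le_pos; auto; left; apply beta_pow_pos. Qed.

Lemma F_pow_S n t : F (beta ^ S n * t) = lam * exp (F (beta ^ n * t)).
Proof. rewrite <- F_eq; f_equal; simpl; ring. Qed.

Lemma F_pow_expand n s t : 0 <= s -> s <= t ->
  beta ^ n * (F t - F s) <= F (beta ^ n * t) - F (beta ^ n * s).
Proof.
  intros hs ht; induction n as [|n IH]; [rewrite !pow_O, !Rmult_1_l; lra|].
  rewrite !F_pow_S.
  assert (beta ^ n * s <= beta ^ n * t)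
    by (apply Rmult_le_compat_l; [left; apply beta_pow_pos | auto]).
  pose proof (Ereal_expand _ _ (F_ge _ (beta_pow_nonneg n s hs)) (F_mono _ _ H)).
  apply Rle_trans with (beta * (F (beta ^ n * t) - F (beta ^ n * s))); auto.
  simpl; rewrite Rmult_assoc; apply Rmult_le_compat_l; lra.
Qed.

Lemma beta_pow_unbounded A d : 0 < d -> exists N, forall n, (N <= n)%nat -> A <= beta ^ n * d.
Proof.
  intros hd.
  destruct (Pow_x_infinity beta ltac:(rewrite Rabs_pos_eq; lra) (A / d)) as [N hN].
  exists N; intros n hn; specialize (hN n hn).
  pose proof (beta_pow_pos n); rewrite Rabs_pos_eq in hN by lra.
  apply Rge_le, (Rmult_le_compat_r d) in hN; [|lra].
  replace (A / d * d) with A in hN by (field; lra); auto.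
Qed.

Lemma F_gap_unbounded A s t : 0 <= s -> s < t ->
  exists N, forall n, (N <= n)%nat -> A <= F (beta ^ n * t) - F (beta ^ n * s).
Proof.
  intros hs ht; pose proof (F_incr s t ht).
  destruct (beta_pow_unbounded A (F t - F s) ltac:(lra)) as [N hN].
  exists N; intros n hn; eapply Rle_trans; [apply (hN n hn)|].
  apply F_pow_expand; lra.
Qed.

Lemma F_unbounded A : exists t, 0 <= t /\ A <= F t.
Proof.
  destruct (F_gap_unbounded A 0 1) as [N hN]; try lra.
  specialize (hN N (Nat.le_refl N)); rewrite Rmult_0_r, F_0 in hN.
  exists (beta ^ N * 1); split; [apply beta_pow_nonneg; lra | lra].
Qed.

(* Chord ratios decrease under the convex map [E], and [F] is asymptotically
   affine at [0]; so the chord inequality at scale [beta^(-n)] passes to [F]. *)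
Lemma F_convex a b c : 0 <= a -> a < b -> b < c ->
  (F b - F a) * (c - b) <= (F c - F b) * (b - a).
Proof.
  intros ha hab hbc.
  assert (hsc : forall n, (F b - F a) * (F ((/ beta) ^ n * c) - F ((/ beta) ^ n * b)) <=
                         (F c - F b) * (F ((/ beta) ^ n * b) - F ((/ beta) ^ n * a))).
  { intros n; induction n as [|n IH]; [rewrite !pow_O, !Rmult_1_l; lra|].
    assert (hq : forall t, F ((/ beta) ^ n * t) = lam * exp (F ((/ beta) ^ S n * t))).
    { intros t; rewrite <- F_eq; f_equal; simpl; field; lra. }
    assert (hlt : forall s t, s < t -> F ((/ beta) ^ S n * s) < F ((/ beta) ^ S n * t)).
    { intros s t hst; apply F_incr, Rmult_lt_compat_l; auto; apply inv_beta_pow. }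
    assert (hlt' : F ((/ beta) ^ n * b) < F ((/ beta) ^ n * c)).
    { apply F_incr, Rmult_lt_compat_l; auto; apply inv_beta_pow. }
    pose proof (hlt a b hab) as h1; pose proof (hlt b c hbc) as h2.
    pose proof (Ereal_chord _ _ _ (Rlt_le _ _ h1) (Rlt_le _ _ h2)) as hc.
    rewrite <- !hq in hc.
    pose proof (F_incr a b hab); pose proof (F_incr b c hbc).
    set (x0 := F b - F a) in *; set (y0 := F c - F b) in *.
    set (x := F ((/ beta) ^ n * b) - F ((/ beta) ^ n * a)) in *.
    set (y := F ((/ beta) ^ n * c) - F ((/ beta) ^ n * b)) in *.
    set (x' := F ((/ beta) ^ S n * b) - F ((/ beta) ^ S n * a)) in *.
    set (y' := F ((/ beta) ^ S n * c) - F ((/ beta) ^ S n * b)) in *.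
    apply (Rmult_le_reg_r y); [unfold y; lra|].
    apply Rle_trans with (y0 * x * y').
    - replace (x0 * y' * y) with (x0 * y * y') by ring.
      apply Rmult_le_compat_r; [unfold y'; lra | auto].
    - replace (y0 * x * y') with (y0 * (x * y')) by ring.
      replace (y0 * x' * y) with (y0 * (y * x')) by ring.
      apply Rmult_le_compat_l; [unfold y0; lra | auto]. }
  apply Rnot_lt_le; intros hlt.
  pose proof (F_incr a b hab); pose proof (F_incr b c hbc).
  set (x0 := F b - F a) in *; set (y0 := F c - F b) in *.
  assert (hx0 : 0 < x0) by (unfold x0; lra); assert (hy0 : 0 < y0) by (unfold y0; lra).
  assert (hcs : 0 < 4 * c * (x0 + y0)) by (apply Rmult_lt_0_compat; lra).
  (* With this choice the accumulated error [2 eta c (x0 + y0)] is half of the assumed defect of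
     convexity. *)
  set (eta := (x0 * (c - b) - y0 * (b - a)) / (4 * c * (x0 + y0))).
  assert (heta : 0 < eta) by (apply Rdiv_lt_0_compat; lra).
  assert (he : eta * (4 * c * (x0 + y0)) = x0 * (c - b) - y0 * (b - a))
    by (unfold eta; field; lra).
  destruct (F_deriv eta heta) as [d hd].
  destruct (pow_mult_lt (/ beta) c d inv_beta_lt_1 (cond_pos d)) as [n hn].
  specialize (hn n (Nat.le_refl n)); specialize (hsc n).
  pose proof (inv_beta_pow n) as hq; set (q := (/ beta) ^ n) in *.
  assert (haff : forall t, 0 <= t -> t <= c ->
             q * t - eta * (q * c) <= F (q * t) - beta <= q * t + eta * (q * c)).
  { intros t [ht | <-] htc.
    - assert (0 < q * t) by (apply Rmult_lt_0_compat; auto).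
      assert (hqc : q * t <= q * c) by (apply Rmult_le_compat_l; lra).
      specialize (hd (q * t) ltac:(lra)); rewrite Rplus_0_l, F_0 in hd.
      rewrite (Rabs_pos_eq (q * t)) in hd by lra; specialize (hd ltac:(lra)).
      apply Rabs_def2 in hd as [k1 k2].
      assert (ef : F (q * t) - beta = (F (q * t) - beta) / (q * t) * (q * t)) by (field; lra).
      set (k := (F (q * t) - beta) / (q * t)) in *; rewrite ef.
      assert (eta * (q * t) <= eta * (q * c)) by (apply Rmult_le_compat_l; lra).
      split; nra.
    - rewrite Rmult_0_r, F_0.
      assert (0 <= eta * (q * c)) by (apply Rmult_le_pos; [lra | apply Rmult_le_pos; lra]).
      lra. }
  pose proof (haff a ha ltac:(lra)); pose proof (haff b ltac:(lra) ltac:(lra)).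
  pose proof (haff c ltac:(lra) ltac:(lra)).
  assert (h1 : x0 * (q * (c - b - 2 * eta * c)) <= y0 * (q * (b - a + 2 * eta * c))).
  { apply Rle_trans with (x0 * (F (q * c) - F (q * b))); [apply Rmult_le_compat_l; lra|].
    eapply Rle_trans; [exact hsc | apply Rmult_le_compat_l; lra]. }
  assert (h2 : x0 * (c - b - 2 * eta * c) <= y0 * (b - a + 2 * eta * c)).
  { apply (Rmult_le_reg_l q); auto; lra. }
  lra.
Qed.

(** Convexity bounds the slope over [[a, b]] by that over [[b, M + 1]], an interval of length at
    least 1. This is the source of continuity, since monotonicity alone would allow jumps. *)
Lemma F_lipschitz M a b : 0 <= a -> a <= b -> b <= M ->
  F b - F a <= (F (M + 1) - beta) * (b - a).
Proof.
  intros ha [hab | <-] hb; [|lra].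
  pose proof (F_convex a b (M + 1) ha hab ltac:(lra)).
  pose proof (F_incr a b hab); pose proof (F_ge b ltac:(lra)).
  apply Rle_trans with ((F b - F a) * (M + 1 - b)); [nra|].
  eapply Rle_trans; [eassumption | apply Rmult_le_compat_r; lra].
Qed.

Lemma F_continuous t : 0 <= t -> continuity_pt F t.
Proof.
  (* Continuity at 0 involves negative arguments, outside the Lipschitz bound, so there it comes
     from the derivative. *)
  intros [ht | <-]; [|apply derivable_continuous_pt; exists 1; auto].
  intros e he.
  set (L := F (t + 1 + 1) - beta).
  assert (hL : 0 <= L) by (unfold L; pose proof (F_ge (t + 1 + 1)); lra).
  exists (Rmin (Rmin t 1) (e / (L + 1))); split.
  - apply Rmin_pos; [apply Rmin_pos; lra | apply Rdiv_lt_0_compat; lra].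
  - intros u [_ hu]; unfold dist in *; simpl in *; unfold Rdist in *.
    pose proof (Rmin_l (Rmin t 1) (e / (L + 1))); pose proof (Rmin_r (Rmin t 1) (e / (L + 1))).
    pose proof (Rmin_l t 1); pose proof (Rmin_r t 1).
    assert (hue : Rabs (u - t) < e / (L + 1)) by lra.
    assert (hut : Rabs (u - t) < Rmin t 1) by lra.
    apply Rabs_def2 in hut.
    assert (hlip : Rabs (F u - F t) <= L * Rabs (u - t)).
    { destruct (Rle_dec t u) as [h | h].
      - pose proof (F_mono _ _ h); rewrite !Rabs_pos_eq by lra; apply F_lipschitz; lra.
      - pose proof (F_mono u t ltac:(lra)); rewrite (Rabs_minus_sym (F u)), (Rabs_minus_sym u).
        rewrite !Rabs_pos_eq by lra; apply F_lipschitz; lra. }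
    eapply Rle_lt_trans; [exact hlip|].
    apply Rle_lt_trans with ((L + 1) * Rabs (u - t));
      [pose proof (Rabs_pos (u - t)); nra|].
    apply (Rmult_lt_compat_l (L + 1)) in hue; [|lra].
    replace ((L + 1) * (e / (L + 1))) with e in hue by (field; lra); auto.
Qed.

Lemma F_continuous_eps t e : 0 <= t -> 0 < e ->
  exists d, 0 < d /\ forall u, Rabs (u - t) < d -> Rabs (F u - F t) < e.
Proof.
  intros ht he; destruct (F_continuous t ht e he) as [d [hd h]]; exists d; split; auto.
  intros u hu; destruct (Req_dec t u) as [-> | hne].
  - rewrite Rminus_diag, Rabs_R0; auto.
  - apply h; split; [split; [exact I | auto] | exact hu].
Qed.

Lemma F_surj y : beta <= y -> exists t, 0 <= t /\ F t = y.
Proof.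
  intros [hy | <-]; [|exists 0; split; [lra | auto]].
  destruct (F_unbounded (y + 1)) as [T [hT hy']].
  assert (0 < T) by (apply F_lt_inv; lra).
  destruct (Ranalysis5.IVT_interv (fun t => F t - y) 0 T) as [t [ht he]]; try lra.
  - intros a ha; apply continuity_pt_minus; [apply F_continuous; lra|].
    apply continuity_pt_const; intros ? ?; auto.
  - exists t; split; lra.
Qed.

Lemma F_surj_pow n y : beta <= y -> exists t, 0 <= t /\ F (beta ^ n * t) = y.
Proof.
  intros hy; destruct (F_surj y hy) as [t [ht he]].
  pose proof (beta_pow_pos n); exists (t / beta ^ n); split.
  - apply Rdiv_le_0_compat; auto.
  - replace (beta ^ n * (t / beta ^ n)) with t by (field; lra); auto.
Qed.

(* [t] is the limit of [beta^(-n) F^(-1)(|E^n(w)|)], the escape rate of [w]. *)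
Definition escape_rate (w : Cx) (t : R) : Prop :=
  0 <= t /\ (forall n, F (beta ^ n * t) <= Re (Eiter lam n w)) /\
  (forall s, t < s -> exists N, forall n, (N <= n)%nat ->
     cnorm (Eiter lam n w) < F (beta ^ n * s)).

(** * Escape rates, and the conclusion for points that lead another *)

(** The rate is the supremum of the [t] whose real orbit [F (beta^n t)] stays below the real parts
    of the orbit of [w]. *)
Lemma escape_rate_exists w : good w -> exists t, escape_rate w t.
Proof.
  intros hw.
  set (A := fun t => 0 <= t /\ forall n, F (beta ^ n * t) <= Re (Eiter lam n w)).
  destruct (completeness A) as [t [hub hlub]].
  - destruct (F_unbounded (Re w + 1)) as [T [_ hT]]; exists T; intros t [_ ht].
    specialize (ht 0%nat); simpl in ht; rewrite Rmult_1_l in ht.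
    left; apply F_lt_inv; lra.
  - exists 0; split; [lra|]; intros n; rewrite Rmult_0_r, F_0; apply hw.
  - assert (h0 : 0 <= t).
    { apply hub; split; [lra|]; intros n; rewrite Rmult_0_r, F_0; apply hw. }
    exists t; split; [|split]; auto.
    (* The supremum is attained: by continuity of [F], a failure at time [n] would persist slightly
       below [t]. *)
    + intros n; apply Rnot_lt_le; intros hlt.
      destruct (F_continuous_eps (beta ^ n * t) (F (beta ^ n * t) - Re (Eiter lam n w)))
        as [d [hd hc]]; [apply beta_pow_nonneg; auto | lra |].
      pose proof (beta_pow_pos n).
      assert (hdb : 0 < d / beta ^ n) by (apply Rdiv_lt_0_compat; auto).
      assert (hbound : is_upper_bound A (t - d / beta ^ n / 2)).
      { intros s hs; apply Rnot_lt_le; intros hst.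
        pose proof (hub s hs) as hle; destruct hs as [_ hs]; specialize (hs n).
        specialize (hc (beta ^ n * s)).
        assert (hh : Rabs (F (beta ^ n * s) - F (beta ^ n * t)) <
                      F (beta ^ n * t) - Re (Eiter lam n w)).
        { apply hc; rewrite <- Rmult_minus_distr_l, Rabs_mult, (Rabs_pos_eq (beta ^ n)) by lra.
          rewrite Rabs_left1 by lra.
          apply Rlt_le_trans with (beta ^ n * (d / beta ^ n)).
          - apply Rmult_lt_compat_l; lra.
          - right; field; lra. }
        apply Rabs_def2 in hh; lra. }
      specialize (hlub _ hbound); lra.
    + intros s hs.
      assert (hns : exists n, Re (Eiter lam n w) < F (beta ^ n * s)).
      { apply NNPP; intros hno; assert (A s).
        { split; [lra|]; intros n; apply Rnot_lt_le; intros h; apply hno; eauto. }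
        specialize (hub s H); lra. }
      (* Once a real part is below [F (beta^N s)], so is the next modulus below [F (beta^(N+1) s)],
         and this propagates. *)
      destruct hns as [N hN]; exists (S N); intros n hn.
      replace n with ((n - S N) + S N)%nat by lia.
      assert (hstep : forall i, Re (Eiter lam i w) < F (beta ^ i * s) ->
                cnorm (Eiter lam (S i) w) < F (beta ^ S i * s)).
      { intros i hi; rewrite cnorm_orbit, F_pow_S.
        apply Rmult_lt_compat_l, exp_increasing; auto. }
      induction (n - S N)%nat as [|i IH]; [apply hstep; auto|].
      apply (hstep (i + S N)%nat); eapply Rle_lt_trans; [apply Re_le_cnorm | exact IH].
Qed.

(** Otherwise [Re E^n(w) - 1] would be [F (beta^n s)] with [s > t], and [shifted_growth] would keep
    the orbit above that of [s], against the definition of the rate. *)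
Lemma ahead_escape_upper c v w t : on_hair c v -> on_hair c w -> ahead w v ->
  escape_rate w t ->
  exists k, forall n, (k <= n)%nat -> Re (Eiter lam n w) <= F (beta ^ n * t) + 1.
Proof.
  intros hv hw ha [ht0 [_ ht]]; destruct (shifted_growth c v w hv hw ha) as [k hk].
  exists k; intros n hn; apply Rnot_lt_le; intros hlt.
  pose proof (F_ge (beta ^ n * t) (beta_pow_nonneg n t ht0)).
  destruct (F_surj_pow n (Re (Eiter lam n w) - 1)) as [s [hs0 hs]]; [lra|].
  assert (hts : t < s).
  { apply (Rmult_lt_reg_l (beta ^ n)); [apply beta_pow_pos | apply F_lt_inv; lra]. }
  destruct (ht s hts) as [N hN].
  assert (hm : forall i, F (beta ^ (i + n) * s) <= Re (Eiter lam (i + n) w) - 1).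
  { intros i; induction i as [|i IH]; [simpl; lra|].
    change (S i + n)%nat with (S (i + n)); rewrite F_pow_S.
    eapply Rle_trans; [apply Ereal_le, IH | apply hk; lia]. }
  specialize (hm N); specialize (hN (N + n)%nat ltac:(lia)).
  pose proof (Re_le_cnorm (Eiter lam (N + n) w)); lra.
Qed.

Lemma ahead_escape_lt c v w s t : on_hair c v -> on_hair c w -> ahead w v ->
  escape_rate v s -> escape_rate w t -> s < t.
Proof.
  intros hv hw ha hs ht; apply Rnot_le_lt; intros hle.
  destruct (ahead_escape_upper c v w t hv hw ha ht) as [k hk].
  apply (not_ahead_of_bounded c v w 1 k hv hw); auto; intros n hn.
  specialize (hk n hn); destruct hs as [hs0 [hs _]]; specialize (hs n).
  assert (F (beta ^ n * t) <= F (beta ^ n * s)).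
  { apply F_mono, Rmult_le_compat_l; auto; left; apply beta_pow_pos. }
  lra.
Qed.

Lemma Eiter_real n x : Re (Eiter lam n (x, 0)) = Nat.iter n (fun u => lam * exp u) x /\
  Im (Eiter lam n (x, 0)) = 0.
Proof.
  induction n as [|n [IH1 IH2]]; [split; reflexivity|].
  simpl; rewrite Re_Efun, Im_Efun, IH1, IH2, cos_0, sin_0; split; ring.
Qed.

Lemma ahead_in_X c v w x0 : on_hair c v -> on_hair c w -> ahead w v -> beta < x0 ->
  exists (eps : R) (k : nat), 0 < eps /\ in_X lam beta F x0 eps (Eiter lam k w).
Proof.
  intros hv hw ha hx0.
  destruct (shifted_growth c v w hv hw ha) as [k1 hk1].
  destruct (ahead_dominates c v w (10 + x0) hv hw ha) as [k2 hk2].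
  set (k := (k1 + k2)%nat).
  destruct (hk2 k ltac:(unfold k; lia)) as [hdom _].
  pose proof (good_cnorm_ge v k (proj1 hv)) as hvk.
  pose proof PI_4; pose proof PI_RGT_0.
  (* The real orbit of [P] bounds [Re E^j] along [w] from below; that of [Q] bounds the imaginary
     parts. The factor [10 + x0] in [hdom] makes [P] exceed both [x0] and [Q]. *)
  set (P := Re (Eiter lam k w) - 1); set (Q := cnorm (Eiter lam k v) + PI).
  assert (hP : x0 < P) by (unfold P; nra).
  assert (hPQ : Q < P) by (unfold P, Q; nra).
  destruct (F_surj P ltac:(lra)) as [p [hp0 hp]].
  destruct (F_surj Q ltac:(unfold Q; lra)) as [q [hq0 hFq]].
  assert (hqp : q < p) by (apply F_lt_inv; lra).
  assert (hq : 0 < q) by (apply F_lt_inv; rewrite F_0, hFq; unfold Q; lra).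
  assert (hlb : 0 < ln beta) by (rewrite <- ln_1; apply ln_increasing; lra).
  assert (hRe : forall j, F (beta ^ j * p) <= Re (Eiter lam (j + k) w) - 1).
  { intros j; induction j as [|j IH]; [simpl; rewrite Rmult_1_l, hp; unfold P; lra|].
    change (S j + k)%nat with (S (j + k)); rewrite F_pow_S.
    eapply Rle_trans; [apply Ereal_le, IH | apply hk1; unfold k; lia]. }
  (* The summand [PI] survives because [E] expands by at least [beta > 1] on [[beta, oo)]. *)
  assert (hIm : forall j, cnorm (Eiter lam (j + k) v) + PI <= F (beta ^ j * q)).
  { intros j; induction j as [|j IH]; [simpl; rewrite Rmult_1_l, hFq; unfold Q; lra|].
    change (S j + k)%nat with (S (j + k)); rewrite F_pow_S, cnorm_orbit.
    pose proof (Re_le_cnorm (Eiter lam (j + k) v)) as h1.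
    pose proof (proj1 hv (j + k)%nat) as h2.
    pose proof (Ereal_expand (Re (Eiter lam (j + k) v)) (F (beta ^ j * q)) h2 ltac:(lra)).
    nra. }
  assert (hx : forall j, x0 <= Re (Eiter lam j (x0, 0)) <= F (beta ^ j * p)).
  { intros j; destruct (Eiter_real j x0) as [-> _]; induction j as [|j [IH1 IH2]].
    - simpl; rewrite Rmult_1_l; lra.
    - rewrite F_pow_S; simpl; split; [|apply Ereal_le; auto].
      pose proof (Ereal_expand beta _ (Rle_refl beta) (Rle_trans _ _ _ (Rlt_le _ _ hx0) IH1)).
      rewrite beta_fix in *; nra. }
  (* The solution [eps] of [beta^(-eps) = q / p]: then [t > beta^j p] gives
     [beta^(-eps) t > beta^j q]. *)
  exists (ln (p / q) / ln beta), k; split.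
  { apply Rdiv_lt_0_compat; auto; rewrite <- ln_1; apply ln_increasing; [lra|].
    apply Rlt_div_r; lra. }
  assert (hpow : Rpower beta (- (ln (p / q) / ln beta)) = q / p).
  { unfold Rpower; replace (- (ln (p / q) / ln beta) * ln beta) with (- ln (p / q)) by (field; lra).
    rewrite exp_Ropp, exp_ln by (apply Rdiv_lt_0_compat; lra); field; lra. }
  intros j; rewrite Eiter_plus, hpow.
  specialize (hRe j); specialize (hIm j); specialize (hx j).
  split; [lra | split; [lra|]].
  destruct (F_surj (Re (Eiter lam (j + k) w)) ltac:(lra)) as [t [ht0 ht]].
  exists t; split; auto.
  pose proof (hair_Im_diff c v w (j + k) hv hw) as hi.
  pose proof (Rabs_Im_le_cnorm (Eiter lam (j + k) v)) as hiv.
  pose proof (Rabs_triang_inv (Im (Eiter lam (j + k) w)) (Im (Eiter lam (j + k) v))).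
  apply Rle_lt_trans with (F (beta ^ j * q)); [lra|].
  assert (hpt : beta ^ j * p < t) by (apply F_lt_inv; lra).
  apply F_incr, (Rmult_lt_reg_r (p / q)); [apply Rdiv_lt_0_compat; lra|].
  replace (beta ^ j * q * (p / q)) with (beta ^ j * p) by (field; lra).
  replace (q / p * t * (p / q)) with t by (field; lra); auto.
Qed.

(** * Limits of points and of orbits *)

Definition cx_lim (p : nat -> Cx) (l : Cx) : Prop :=
  forall e, 0 < e -> exists N, forall n, (N <= n)%nat -> cdist (p n) l < e.

Lemma cx_lim_unique p k l : cx_lim p k -> cx_lim p l -> k = l.
Proof.
  intros hk hl; apply cdist_eq, Rle_antisym; [|apply cdist_pos].
  apply le_epsilon; intros e he; rewrite Rplus_0_l.
  destruct (hk (e / 2) ltac:(lra)) as [N hN], (hl (e / 2) ltac:(lra)) as [N' hN'].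
  specialize (hN (N + N')%nat ltac:(lia)); specialize (hN' (N + N')%nat ltac:(lia)).
  pose proof (cdist_triangle k (p (N + N')%nat) l) as h.
  rewrite (cdist_sym k (p _)) in h; lra.
Qed.

Lemma cx_lim_S p l : cx_lim p l -> cx_lim (fun n => p (S n)) l.
Proof.
  intros h e he; destruct (h e he) as [N hN]; exists N; intros n hn; apply hN; lia.
Qed.

Lemma cx_lim_cdist_le p l x K : cx_lim p l -> (forall n, cdist (p n) x <= K) -> cdist l x <= K.
Proof.
  intros hl hK; apply le_epsilon; intros e he; destruct (hl e he) as [N hN].
  specialize (hN N (Nat.le_refl N)); specialize (hK N).
  pose proof (cdist_triangle l (p N) x) as h; rewrite (cdist_sym l (p N)) in h; lra.
Qed.

Lemma cx_complete p :
  (forall e, 0 < e -> exists N, forall m n, (N <= m)%nat -> (N <= n)%nat ->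
     cdist (p m) (p n) < e) ->
  exists l, cx_lim p l.
Proof.
  intros hp.
  destruct (Rcomplete.R_complete (fun n => Re (p n))) as [a ha].
  { intros e he; destruct (hp e he) as [N hN]; exists N; intros m n hm hn.
    eapply Rle_lt_trans; [apply Rabs_Re_le_cdist | apply hN; auto]. }
  destruct (Rcomplete.R_complete (fun n => Im (p n))) as [b hb].
  { intros e he; destruct (hp e he) as [N hN]; exists N; intros m n hm hn.
    eapply Rle_lt_trans; [apply Rabs_Im_le_cdist | apply hN; auto]. }
  exists (a, b); intros e he.
  destruct (ha (e / 2) ltac:(lra)) as [N hN], (hb (e / 2) ltac:(lra)) as [N' hN'].
  exists (N + N')%nat; intros n hn.
  specialize (hN n ltac:(lia)); specialize (hN' n ltac:(lia)).
  unfold Rdist in hN, hN'; pose proof (cdist_le (p n) (a, b)) as h.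
  change (Re (a, b)) with a in h; change (Im (a, b)) with b in h; lra.
Qed.

Lemma geometric_limit p D q : 0 <= q < 1 ->
  (forall m, cdist (p (S m)) (p m) <= q ^ m * D) ->
  exists l, cx_lim p l /\ cdist l (p O) <= D / (1 - q).
Proof.
  intros hq hp.
  assert (hk : forall m k, cdist (p (k + m)%nat) (p m) <= q ^ m * (D / (1 - q))).
  { intros m k.
    assert (hD : 0 <= D).
    { pose proof (hp O) as h; pose proof (cdist_pos (p 1%nat) (p O)); simpl in h; lra. }
    assert (h : cdist (p (k + m)%nat) (p m) <= q ^ m * (D * (1 - q ^ k) / (1 - q))).
    { induction k as [|k IH].
      - pose proof (cdist_le (p m) (p m)) as h; rewrite !Rminus_diag, !Rabs_R0 in h.
        simpl; replace (q ^ m * (D * (1 - 1) / (1 - q))) with 0 by (field; lra); lra.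
      - pose proof (cdist_triangle (p (S k + m)%nat) (p (k + m)%nat) (p m)) as h.
        pose proof (hp (k + m)%nat) as h'; rewrite pow_add in h'.
        replace (q ^ m * (D * (1 - q ^ S k) / (1 - q))) with
          (q ^ k * q ^ m * D + q ^ m * (D * (1 - q ^ k) / (1 - q))) by (simpl; field; lra).
        simpl in h |- *; lra. }
    eapply Rle_trans; [exact h|].
    pose proof (pow_le q m (proj1 hq)); pose proof (pow_le q k (proj1 hq)).
    apply Rmult_le_compat_l; auto; apply Rmult_le_compat_r; [|nra].
    left; apply Rinv_0_lt_compat; lra. }
  destruct (cx_complete p) as [l hl].
  { intros e he; destruct (pow_mult_lt q (D / (1 - q)) (e / 2) hq ltac:(lra)) as [N hN].
    specialize (hN N (Nat.le_refl N)).
    exists N; intros m n hm hn.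
    pose proof (hk N (m - N)%nat) as h1; pose proof (hk N (n - N)%nat) as h2.
    replace (m - N + N)%nat with m in h1 by lia; replace (n - N + N)%nat with n in h2 by lia.
    pose proof (cdist_triangle (p m) (p N) (p n)) as h; rewrite (cdist_sym (p N) (p n)) in h; lra. }
  exists l; split; auto; apply (cx_lim_cdist_le p); auto; intros n.
  pose proof (hk O n) as h; rewrite Nat.add_0_r in h; simpl in h; lra.
Qed.

Lemma Re_lim_ge p l b : cx_lim p l -> (forall n, b <= Re (p n)) -> b <= Re l.
Proof.
  intros hl hb; apply le_epsilon; intros e he; destruct (hl e he) as [N hN].
  specialize (hN N (Nat.le_refl N)); specialize (hb N).
  pose proof (Rabs_Re_le_cdist (p N) l) as h; apply Rabs_le_between in h; lra.
Qed.

Lemma clog_lim c p l : (forall n, beta <= Re (p n)) -> cx_lim p l ->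
  cx_lim (fun n => clog lam c (p n)) (clog lam c l).
Proof.
  intros hp hl e he; destruct (hl e he) as [N hN]; exists N; intros n hn.
  specialize (hN n hn).
  pose proof (clog_contract lam beta c l (p n) lam_pos ltac:(lra) (Re_lim_ge p l beta hl hp) (hp n)).
  pose proof (cdist_pos (clog lam c (p n)) (clog lam c l)); nra.
Qed.

Lemma on_hair_of_clog c l : (forall n, cos (c n) = 1 /\ sin (c n) = 0) ->
  (forall n, beta <= Re (l n)) -> (forall n, l n = clog lam (c n) (l (S n))) ->
  (forall n, Eiter lam n (l O) = l n) /\ on_hair c (l O).
Proof.
  intros hc hl hlog.
  assert (hE : forall n, Eiter lam n (l O) = l n).
  { intros n; induction n as [|n IH]; auto.
    simpl; rewrite IH, hlog; apply Efun_clog; [auto | apply hc | apply hc |].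
    specialize (hl (S n)); lra. }
  split; auto; split.
  - intros n; rewrite hE; auto.
  - intros n; unfold turn; rewrite !hE, hlog, Im_clog; ring.
Qed.

(** Limits are taken at each time separately; the branches are continuous, so the limits form a
    backward orbit along [c], which [on_hair_of_clog] turns into a point of the hair. *)
Lemma hair_closed c ws : (forall n, cos (c n) = 1 /\ sin (c n) = 0) ->
  (forall i, on_hair c (ws i)) ->
  (forall j e, 0 < e -> exists N, forall m n, (N <= m)%nat -> (N <= n)%nat ->
     cdist (Eiter lam j (ws m)) (Eiter lam j (ws n)) < e) ->
  exists w, on_hair c w /\ forall j, cx_lim (fun i => Eiter lam j (ws i)) (Eiter lam j w).
Proof.
  intros hc hws hcau.
  assert (hex : forall j, exists l, cx_lim (fun i => Eiter lam j (ws i)) l)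
    by (intros j; apply cx_complete, hcau).
  set (l := fun j => proj1_sig (constructive_indefinite_description _ (hex j))).
  assert (hl : forall j, cx_lim (fun i => Eiter lam j (ws i)) (l j))
    by (intros j; exact (proj2_sig (constructive_indefinite_description _ (hex j)))).
  destruct (on_hair_of_clog c l hc) as [hE hh].
  - intros n; apply (Re_lim_ge _ _ _ (hl n)); intros i; apply (proj1 (hws i)).
  - intros n.
    assert (hn : cx_lim (fun i => Eiter lam n (ws i)) (clog lam (c n) (l (S n)))).
    { intros e he.
      destruct (clog_lim (c n) _ (l (S n)) (fun i => proj1 (hws i) (S n)) (hl (S n)) e he)
        as [N hN]; exists N; intros i hi.
      rewrite <- clog_turn, (proj2 (hws i)); apply hN; auto. }
    apply (cx_lim_unique _ _ _ (hl n) hn).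
  - exists (l O); split; auto; intros j; rewrite hE; apply hl.
Qed.

(** * Points of prescribed escape rate *)

(** The modulus is at most [1 + M] times the real part, so the logarithm moves the real part by at
    most [ln (1 + M) <= M]. *)
Lemma clog_vertical_le c x y y' M : 0 <= M -> Rabs y' <= M * (lam * exp x) ->
  Rabs (c + carg (lam * exp x, y') - y) <= PI ->
  cdist (clog lam c (lam * exp x, y')) (x, y) <= M + PI.
Proof.
  intros hM hy hc.
  pose proof (cdist_le (clog lam c (lam * exp x, y')) (x, y)) as h.
  rewrite Re_clog, Im_clog in h.
  change (Re (x, y)) with x in h; change (Im (x, y)) with y in h.
  set (p := (lam * exp x, y')) in *.
  pose proof (exp_pos x) as hx.
  pose proof (Re_le_cnorm p) as h1; pose proof (cnorm_le p) as h2.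
  change (Re p) with (lam * exp x) in h1, h2; change (Im p) with y' in h2.
  assert (0 < lam * exp x) by nra.
  rewrite (Rabs_pos_eq (lam * exp x)) in h2 by lra.
  assert (Rabs (ln (cnorm p / lam) - x) <= M); [|lra].
  rewrite Rabs_pos_eq.
  - assert (ln (cnorm p / lam) <= ln (exp (x + M))); [|rewrite ln_exp in *; lra].
    apply ln_le; [apply Rdiv_lt_0_compat; lra|].
    apply Rle_div_l; auto; rewrite exp_plus; pose proof (exp_ineq1_le M); nra.
  - assert (ln (exp x) <= ln (cnorm p / lam)); [|rewrite ln_exp in *; lra].
    apply ln_le; auto; apply Rle_div_r; lra.
Qed.

(** Shadowing: the points [p n] form a pseudo-orbit with errors at most [M + PI], which contracting
    inverse branches correct to a true orbit at distance at most a geometric sum. *)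
Lemma hair_point z t M : good z -> 0 <= t -> 0 <= M ->
  (forall n, Rabs (Im (Eiter lam n z)) <= M * F (beta ^ n * t)) ->
  exists w, on_hair (turn z) w /\
    forall n, Rabs (Re (Eiter lam n w) - F (beta ^ n * t)) <= (M + PI) / (1 - / beta).
Proof.
  intros hz ht hM hIm.
  set (c := turn z); set (p := fun n => (F (beta ^ n * t), Im (Eiter lam n z))).
  assert (hp : forall n, beta <= Re (p n)) by (intros n; apply F_ge, beta_pow_nonneg; auto).
  assert (hstep : forall n, cdist (clog lam (c n) (p (S n))) (p n) <= M + PI).
  { intros n; unfold p; rewrite F_pow_S; apply clog_vertical_le; auto.
    - rewrite <- F_pow_S; apply hIm.
    - unfold c, turn; pose proof (carg_bound (Eiter lam (S n) z)).
      match goal with |- Rabs (_ + carg ?v - _) <= _ => pose proof (carg_bound v) end.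
      apply Rabs_le; lra. }
  assert (hlim : forall j, exists l, cx_lim (fun m => pull c j m (p (j + m)%nat)) l /\
             cdist l (p j) <= (M + PI) / (1 - / beta)).
  { intros j.
    destruct (geometric_limit (fun m => pull c j m (p (j + m)%nat)) (M + PI) (/ beta))
      as [l [hl hd]]; [apply inv_beta_lt_1| |].
    - intros m; rewrite pull_S, Nat.add_succ_r.
      eapply Rle_trans; [apply pull_contract; auto; apply (Re_clog_ge lam beta); auto|].
      apply Rmult_le_compat_l; [left; apply inv_beta_pow | auto].
    - exists l; split; auto; simpl in hd; rewrite Nat.add_0_r in hd; auto. }
  set (l := fun j => proj1_sig (constructive_indefinite_description _ (hlim j))).
  assert (hl : forall j, cx_lim (fun m => pull c j m (p (j + m)%nat)) (l j) /\
             cdist (l j) (p j) <= (M + PI) / (1 - / beta))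
    by (intros j; exact (proj2_sig (constructive_indefinite_description _ (hlim j)))).
  assert (hge : forall j m, beta <= Re (pull c j m (p (j + m)%nat)))
    by (intros; apply Re_pull_ge; auto).
  destruct (on_hair_of_clog c l) as [hE hh].
  - intros n; apply turn_trig; auto.
  - intros n; apply (Re_lim_ge _ _ _ (proj1 (hl n))); auto.
  (* This sequence is a tail of the one defining [l n], and also the branch [c n] applied to the one
     defining [l (S n)]. *)
  - intros n; apply (cx_lim_unique (fun m => pull c n (S m) (p (n + S m)%nat))).
    + apply (cx_lim_S (fun m => pull c n m (p (n + m)%nat))), hl.
    + intros e he.
      destruct (clog_lim (c n) _ _ (hge (S n)) (proj1 (hl (S n))) e he) as [N hN].
      exists N; intros m hm; rewrite Nat.add_succ_r; apply (hN m hm).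
  - exists (l O); split; auto; intros n; rewrite hE.
    eapply Rle_trans; [apply (Rabs_Re_le_cdist (l n) (p n)) | apply hl].
Qed.

Lemma finite_bound (u : nat -> R) N : exists B, 0 <= B /\ forall n, (n < N)%nat -> u n <= B.
Proof.
  induction N as [|N [B [hB h]]]; [exists 0; split; [lra | intros; lia]|].
  exists (Rmax B (u N)); split; [eapply Rle_trans; [exact hB | apply Rmax_l]|].
  intros n hn; destruct (Nat.eq_dec n N) as [-> | hne]; [apply Rmax_r|].
  eapply Rle_trans; [apply h; lia | apply Rmax_l].
Qed.

(** * The hair of a minimal point, parametrized by escape rate *)

Section MinimalPoint.

Variables (z : Cx) (t0 : R).
Hypotheses (z_good : good z) (z_rate : escape_rate z t0)
  (z_min : forall w, on_hair (turn z) w -> w <> z -> ahead w z).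

Let c := turn z.

Lemma t0_nonneg : 0 <= t0.
Proof. apply z_rate. Qed.

Lemma z_on_hair : on_hair c z.
Proof. split; auto. Qed.

(** Free [K] and [N] admit both the points from shadowing, close at all times, and arbitrary points
    of rate [t], close only eventually. *)
Definition hair_at (t : R) (w : Cx) : Prop :=
  on_hair c w /\ exists K N, forall n, (N <= n)%nat ->
    Rabs (Re (Eiter lam n w) - F (beta ^ n * t)) <= K.

Lemma hair_at_unique t v w : hair_at t v -> hair_at t w -> w = v.
Proof.
  intros [hv [K [N h]]] [hw [K' [N' h']]]; apply (hair_eq c v w (K + K')); auto.
  intros m; exists (m + N + N')%nat; split; [lia|].
  specialize (h (m + N + N')%nat ltac:(lia)); specialize (h' (m + N + N')%nat ltac:(lia)).
  apply Rabs_le_between in h, h'; apply Rabs_le; lra.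
Qed.

Lemma hair_at_not_ahead s t v w : 0 <= s -> s <= t -> hair_at s v -> hair_at t w -> ~ ahead v w.
Proof.
  intros hs hst [hv [K [N h]]] [hw [K' [N' h']]].
  apply (not_ahead_of_bounded c w v (K + K') (N + N') hw hv); intros n hn.
  specialize (h n ltac:(lia)); specialize (h' n ltac:(lia)).
  assert (F (beta ^ n * s) <= F (beta ^ n * t)).
  { apply F_mono, Rmult_le_compat_l; auto; left; apply beta_pow_pos. }
  apply Rabs_le_between in h, h'; lra.
Qed.

Lemma hair_at_lt_inj s t w : 0 <= s -> s < t -> hair_at s w -> ~ hair_at t w.
Proof.
  intros hs hst [_ [K [N h]]] [_ [K' [N' h']]].
  destruct (F_gap_unbounded (K + K' + 1) s t hs hst) as [m hm].
  specialize (hm (m + N + N')%nat ltac:(lia)).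
  specialize (h (m + N + N')%nat ltac:(lia)); specialize (h' (m + N + N')%nat ltac:(lia)).
  apply Rabs_le_between in h, h'; lra.
Qed.

Lemma z_not_hair_at t : t0 < t -> ~ hair_at t z.
Proof.
  intros ht [_ [K [N h]]]; pose proof t0_nonneg.
  destruct (proj2 (proj2 z_rate) ((t0 + t) / 2) ltac:(lra)) as [N' h'].
  destruct (F_gap_unbounded (K + 1) ((t0 + t) / 2) t ltac:(lra) ltac:(lra)) as [m hm].
  specialize (hm (m + N + N')%nat ltac:(lia)).
  specialize (h (m + N + N')%nat ltac:(lia)); specialize (h' (m + N + N')%nat ltac:(lia)).
  pose proof (Re_le_cnorm (Eiter lam (m + N + N') z)).
  apply Rabs_le_between in h; lra.
Qed.

(** Past some [N] the imaginary parts along [z] are below [F (beta^n t1)]; the finitely many earlier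
    ones are at most [B], and [F > 1]. So [M = B + 1] serves in [hair_point] for every [t >= t1]. *)
Lemma hair_at_uniform t1 : t0 < t1 -> exists K, forall t, t1 <= t ->
  exists w, hair_at t w /\ forall n, Rabs (Re (Eiter lam n w) - F (beta ^ n * t)) <= K.
Proof.
  intros ht1; pose proof t0_nonneg.
  destruct (proj2 (proj2 z_rate) t1 ht1) as [N hN].
  destruct (finite_bound (fun n => Rabs (Im (Eiter lam n z))) N) as [B [hB hBn]].
  exists ((B + 1 + PI) / (1 - / beta)); intros t ht.
  destruct (hair_point z t (B + 1)) as [w [hw hwn]]; auto; try lra.
  - intros n.
    assert (hF : F (beta ^ n * t1) <= F (beta ^ n * t)).
    { apply F_mono, Rmult_le_compat_l; auto; left; apply beta_pow_pos. }
    assert (hF1 : beta <= F (beta ^ n * t1)) by (apply F_ge, beta_pow_nonneg; lra).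
    destruct (le_lt_dec N n) as [h | h].
    + specialize (hN n h); pose proof (Rabs_Im_le_cnorm (Eiter lam n z)); nra.
    + specialize (hBn n h); simpl in hBn; nra.
  - exists w; split; auto; split; auto; eexists; exists 0%nat; intros; apply hwn.
Qed.

Definition hair_pt (t : R) : Cx := epsilon (inhabits z) (hair_at t).

Lemma hair_pt_spec t : t0 < t -> hair_at t (hair_pt t).
Proof.
  intros ht; unfold hair_pt; apply epsilon_spec.
  destruct (hair_at_uniform t ht) as [K hK]; destruct (hK t (Rle_refl t)) as [w [hw _]]; eauto.
Qed.

Lemma hair_pt_uniform t1 : t0 < t1 -> exists K, forall t, t1 <= t -> forall n,
  Rabs (Re (Eiter lam n (hair_pt t)) - F (beta ^ n * t)) <= K.
Proof.
  intros ht1; destruct (hair_at_uniform t1 ht1) as [K hK]; exists K; intros t ht.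
  destruct (hK t ht) as [w [hw hwn]].
  rewrite (hair_at_unique t w (hair_pt t)); auto; apply hair_pt_spec; lra.
Qed.

(** By minimality [w] leads [z], so its escape rate exceeds [t0] and its real parts stay within 1 of
    [F (beta^n t)] eventually. *)
Lemma hair_pt_surj w : on_hair c w -> w <> z -> exists t, t0 < t /\ hair_pt t = w.
Proof.
  intros hw hne; pose proof (z_min w hw hne) as ha.
  destruct (escape_rate_exists w (proj1 hw)) as [t ht].
  pose proof (ahead_escape_lt c z w t0 t z_on_hair hw ha z_rate ht) as hlt.
  exists t; split; auto; apply (hair_at_unique t); [|apply hair_pt_spec; auto].
  destruct (ahead_escape_upper c z w t z_on_hair hw ha ht) as [k hk].
  split; auto; exists 1, k; intros n hn; specialize (hk n hn).
  pose proof (proj1 (proj2 ht) n); apply Rabs_le; lra.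
Qed.

Lemma hair_pt_continuous t e : t0 < t -> 0 < e -> exists d, 0 < d /\
  forall s, Rabs (s - t) < d -> cdist (hair_pt s) (hair_pt t) < e.
Proof.
  intros ht he; pose proof t0_nonneg.
  destruct (hair_pt_uniform ((t0 + t) / 2) ltac:(lra)) as [K hK].
  (* At time [n]: [K] for each distance to the real orbit, 1 for the variation of [F], [PI] for the
     imaginary parts. First [n] is fixed, then [s] is taken close to [t]. *)
  destruct (pow_mult_lt (/ beta) (2 * K + 1 + PI) e inv_beta_lt_1 he) as [n hn].
  specialize (hn n (Nat.le_refl n)); pose proof (beta_pow_pos n).
  destruct (F_continuous_eps (beta ^ n * t) 1) as [d [hd hc]];
    [apply beta_pow_nonneg; lra | lra |].
  exists (Rmin ((t - t0) / 2) (d / beta ^ n)); split.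
  { apply Rmin_pos; [lra | apply Rdiv_lt_0_compat; auto]. }
  intros s hs.
  pose proof (Rmin_l ((t - t0) / 2) (d / beta ^ n)).
  pose proof (Rmin_r ((t - t0) / 2) (d / beta ^ n)).
  assert (h1 : Rabs (s - t) < (t - t0) / 2) by lra.
  assert (h2 : Rabs (s - t) < d / beta ^ n) by lra.
  assert (h3 : Rabs (F (beta ^ n * s) - F (beta ^ n * t)) < 1).
  { apply hc; rewrite <- Rmult_minus_distr_l, Rabs_mult, (Rabs_pos_eq (beta ^ n)) by lra.
    apply (Rmult_lt_compat_l (beta ^ n)) in h2; auto.
    replace (beta ^ n * (d / beta ^ n)) with d in h2 by (field; lra); auto. }
  apply Rabs_def2 in h1, h3.
  pose proof (hK s ltac:(lra) n) as k1; pose proof (hK t ltac:(lra) n) as k2.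
  apply Rabs_le_between in k1, k2.
  pose proof (proj1 (hair_pt_spec s ltac:(lra))) as hs'.
  pose proof (proj1 (hair_pt_spec t ht)) as ht'.
  eapply Rle_lt_trans; [apply (hair_expand c _ _ 0 n ht' hs')|].
  eapply Rle_lt_trans; [|exact hn].
  apply Rmult_le_compat_l; [left; apply inv_beta_pow|].
  apply (hair_cdist_le c); auto; simpl Nat.add; apply Rabs_le; lra.
Qed.

(* Up to an error of 6 the real parts [Re (E^n (hair_pt t))] increase with [t],
   so they oscillate by at most 7 near [t0]. *)
Lemma hair_pt_oscillation n : exists d, 0 < d /\
  forall s t, t0 < s < t0 + d -> t0 < t < t0 + d ->
    Rabs (Re (Eiter lam n (hair_pt s)) - Re (Eiter lam n (hair_pt t))) <= 7.
Proof.
  pose proof t0_nonneg.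
  (* Negated, so that the supremum from [completeness] yields the infimum of the real parts. *)
  set (A := fun y => exists t, t0 < t /\ y = - Re (Eiter lam n (hair_pt t))).
  destruct (completeness A) as [m [hub hlub]].
  - exists (- beta); intros y [t [ht ->]].
    pose proof (proj1 (proj1 (hair_pt_spec t ht)) n); lra.
  - exists (- Re (Eiter lam n (hair_pt (t0 + 1)))); exists (t0 + 1); split; auto; lra.
  - assert (hex : exists t, t0 < t /\ Re (Eiter lam n (hair_pt t)) < - m + 1).
    { apply NNPP; intros hno.
      assert (hb : is_upper_bound A (m - 1)).
      { intros y [t [ht ->]]; apply Rnot_lt_le; intros hl; apply hno; exists t; split; lra. }
      specialize (hlub _ hb); lra. }
    destruct hex as [t1 [ht1 hm1]]; exists (t1 - t0); split; [lra|].
    assert (hb : forall s, t0 < s < t0 + (t1 - t0) ->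
               - m <= Re (Eiter lam n (hair_pt s)) <= - m + 7).
    { intros s hs; split.
      - assert (hA : A (- Re (Eiter lam n (hair_pt s)))) by (exists s; split; [lra | auto]).
        specialize (hub _ hA); lra.
      - apply Rnot_lt_le; intros hl.
        apply (hair_at_not_ahead s t1 (hair_pt s) (hair_pt t1)); try lra;
          [apply hair_pt_spec; lra | apply hair_pt_spec; lra |].
        exists n; lra. }
    intros s t hs ht; pose proof (hb s hs); pose proof (hb t ht); apply Rabs_le; lra.
Qed.

Lemma hair_pt_cauchy j e : 0 < e -> exists d, 0 < d /\
  forall s t, t0 < s < t0 + d -> t0 < t < t0 + d ->
    cdist (Eiter lam j (hair_pt s)) (Eiter lam j (hair_pt t)) < e.
Proof.
  intros he.
  destruct (pow_mult_lt (/ beta) (7 + PI) e inv_beta_lt_1 he) as [n hn].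
  specialize (hn n (Nat.le_refl n)).
  destruct (hair_pt_oscillation (j + n)) as [d [hd ho]].
  exists d; split; auto; intros s t hs ht.
  pose proof (proj1 (hair_pt_spec s ltac:(lra))) as hs'.
  pose proof (proj1 (hair_pt_spec t ltac:(lra))) as ht'.
  eapply Rle_lt_trans; [apply (hair_expand c _ _ j n ht' hs')|].
  eapply Rle_lt_trans; [|exact hn].
  apply Rmult_le_compat_l; [left; apply inv_beta_pow|].
  apply (hair_cdist_le c); auto.
Qed.

(* The curve converges as [t] decreases to [t0]; its limit lies on the hair, and
   it cannot be ahead of [z], for it would then be ahead of [hair_pt t] for some
   [t > t0]. *)
Lemma hair_pt_limit e : 0 < e -> exists d, 0 < d /\
  forall t, t0 < t < t0 + d -> cdist (hair_pt t) z < e.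
Proof.
  intros he; pose proof t0_nonneg.
  set (u := fun i => t0 + / (INR i + 1)).
  assert (hu0 : forall i, t0 < u i).
  { intros i; unfold u; pose proof (pos_INR i).
    assert (0 < / (INR i + 1)) by (apply Rinv_0_lt_compat; lra); lra. }
  assert (hu : forall d, 0 < d -> exists N, forall i, (N <= i)%nat -> t0 < u i < t0 + d).
  { intros d hd; destruct (archimed_cor1 d hd) as [N [hN hN0]]; exists N; intros i hi.
    split; auto; unfold u; apply Rplus_lt_compat_l; eapply Rle_lt_trans; [|exact hN].
    apply le_INR in hi; apply lt_0_INR in hN0; apply Rinv_le_contravar; lra. }
  destruct (hair_closed c (fun i => hair_pt (u i))) as [w [hw hlim]].
  - intros n; apply turn_trig; auto.
  - intros i; apply hair_pt_spec; auto.
  - intros j e' he'; destruct (hair_pt_cauchy j e' he') as [d [hd hc]].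
    destruct (hu d hd) as [N hN]; exists N; intros m n hm hn; apply hc; apply hN; auto.
  - assert (hwz : w = z).
    { apply NNPP; intros hne.
      destruct (escape_rate_exists w (proj1 hw)) as [t ht].
      pose proof (ahead_escape_lt c z w t0 t z_on_hair hw (z_min w hw hne) z_rate ht) as hlt.
      destruct (hair_pt_spec ((t0 + t) / 2) ltac:(lra)) as [hv [K [N hK]]].
      (* [K] for the distance of the midpoint's orbit to its real orbit, 6 for the lead, 1 for
         approximating [w]. *)
      destruct (F_gap_unbounded (K + 7) ((t0 + t) / 2) t ltac:(lra) ltac:(lra)) as [m hm].
      set (n := (m + N)%nat).
      specialize (hm n ltac:(unfold n; lia)); specialize (hK n ltac:(unfold n; lia)).
      pose proof (proj1 (proj2 ht) n) as hwn.
      destruct (hlim n 1 ltac:(lra)) as [N1 h1].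
      destruct (hu ((t - t0) / 2) ltac:(lra)) as [N2 h2].
      specialize (h1 (N1 + N2)%nat ltac:(lia)); specialize (h2 (N1 + N2)%nat ltac:(lia)).
      set (i := (N1 + N2)%nat) in *; cbv beta in h1.
      pose proof (Rabs_Re_le_cdist (Eiter lam n (hair_pt (u i))) (Eiter lam n w)) as h3.
      apply Rabs_le_between in hK, h3.
      apply (hair_at_not_ahead (u i) ((t0 + t) / 2) (hair_pt (u i)) (hair_pt ((t0 + t) / 2)));
        try lra; [apply hair_pt_spec; lra | apply hair_pt_spec; lra |].
      exists n; lra. }
    subst w.
    destruct (hair_pt_cauchy 0 (e / 2) ltac:(lra)) as [d [hd hc]].
    exists d; split; auto; intros t ht.
    destruct (hu d hd) as [N hN]; destruct (hlim 0%nat (e / 2) ltac:(lra)) as [N' hN'].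
    specialize (hN (N + N')%nat ltac:(lia)); specialize (hN' (N + N')%nat ltac:(lia)).
    pose proof (hc t (u (N + N')%nat) ht hN) as h1; simpl in h1, hN'.
    pose proof (cdist_triangle (hair_pt t) (hair_pt (u (N + N')%nat)) z); lra.
Qed.

(** Constant for [u <= 0], since [is_endpoint] asks for two-sided continuity at 0. *)
Definition hair_curve (u : R) : Cx := if Rle_dec u 0 then z else hair_pt (t0 + u).

Lemma hair_curve_nonpos u : u <= 0 -> hair_curve u = z.
Proof. intros h; unfold hair_curve; destruct (Rle_dec u 0); tauto. Qed.

Lemma hair_curve_pos u : 0 < u -> hair_curve u = hair_pt (t0 + u).
Proof. intros h; unfold hair_curve; destruct (Rle_dec u 0); [lra | auto]. Qed.

Lemma hair_curve_on_hair u : on_hair c (hair_curve u).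
Proof.
  unfold hair_curve; destruct (Rle_dec u 0); [apply z_on_hair|].
  apply hair_pt_spec; lra.
Qed.

Lemma hair_curve_continuous u e : 0 <= u -> 0 < e -> exists d, 0 < d /\
  forall v, Rabs (v - u) < d -> cdist (hair_curve v) (hair_curve u) < e.
Proof.
  intros [hu | <-] he.
  - destruct (hair_pt_continuous (t0 + u) e ltac:(lra) he) as [d [hd hc]].
    exists (Rmin d u); split; [apply Rmin_pos; auto|]; intros v hv.
    pose proof (Rmin_l d u); pose proof (Rmin_r d u).
    assert (hv' : Rabs (v - u) < u) by lra; apply Rabs_def2 in hv'.
    rewrite !hair_curve_pos by lra; apply hc.
    replace (t0 + v - (t0 + u)) with (v - u) by ring; lra.
  - destruct (hair_pt_limit e he) as [d [hd hc]]; exists d; split; auto; intros v hv.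
    rewrite (hair_curve_nonpos 0) by lra; rewrite Rminus_0_r in hv; apply Rabs_def2 in hv.
    destruct (Rle_dec v 0) as [h | h].
    + rewrite hair_curve_nonpos by auto.
      eapply Rle_lt_trans; [apply cdist_le|].
      rewrite !Rminus_diag, Rabs_R0; lra.
    + rewrite hair_curve_pos by lra; apply hc; lra.
Qed.

Lemma hair_curve_inj u v : 0 <= u -> u < v -> hair_curve u <> hair_curve v.
Proof.
  intros hu hv he; pose proof t0_nonneg.
  rewrite (hair_curve_pos v) in he by lra.
  pose proof (hair_pt_spec (t0 + v) ltac:(lra)) as hs; rewrite <- he in hs.
  destruct hu as [hu | <-].
  - rewrite hair_curve_pos in hs by auto.
    apply (hair_at_lt_inj (t0 + u) (t0 + v) _ ltac:(lra) ltac:(lra)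
             (hair_pt_spec (t0 + u) ltac:(lra)) hs).
  - rewrite hair_curve_nonpos in hs by lra; revert hs; apply z_not_hair_at; lra.
Qed.

Lemma minimal_is_endpoint : is_endpoint lam z.
Proof.
  pose proof t0_nonneg.
  split; [apply Julia_of_good; auto|].
  exists hair_curve; split; [apply hair_curve_nonpos; lra|].
  split; [|split; [|split; [|split]]].
  - intros u _; apply hair_iff; auto; apply hair_curve_on_hair.
  - intros w hw; apply hair_iff in hw; auto.
    destruct (classic (w = z)) as [-> | hne].
    + exists 0; split; [lra | apply hair_curve_nonpos; lra].
    + destruct (hair_pt_surj w hw hne) as [t [ht <-]].
      exists (t - t0); split; [lra|].
      rewrite hair_curve_pos by lra; f_equal; ring.
  - intros u hu; split; intros e he; destruct (hair_curve_continuous u e hu he) as [d [hd hc]];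
      exists d; split; auto; intros v [_ hv]; eapply Rle_lt_trans; [| apply hc, hv | | apply hc, hv].
    + apply Rabs_Re_le_cdist.
    + apply Rabs_Im_le_cdist.
  - intros u v hu hv he; destruct (Rtotal_order u v) as [h | [h | h]]; auto; exfalso.
    + apply (hair_curve_inj u v); auto.
    + apply (hair_curve_inj v u); auto.
  (* Already at time 0 the real part is within [K] of [F (t0 + u)], which is unbounded. *)
  - intros M; destruct (hair_pt_uniform (t0 + 1) ltac:(lra)) as [K hK].
    destruct (F_unbounded (M + K + 1)) as [T [hT hFT]].
    exists (T + 1); intros u hu; rewrite hair_curve_pos by lra.
    specialize (hK (t0 + u) ltac:(lra) 0%nat); simpl in hK; rewrite Rmult_1_l in hK.
    pose proof (F_mono T (t0 + u) ltac:(lra)).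
    pose proof (Re_le_cnorm (hair_pt (t0 + u))); apply Rabs_le_between in hK; lra.
Qed.

End MinimalPoint.

(** If [z] leads some point of its hair, [ahead_in_X] applies; otherwise, by totality of the order,
    [z] is minimal. *)
Lemma in_X_or_endpoint x0 z : beta < x0 -> good z ->
  (exists (eps : R) (k : nat), 0 < eps /\ in_X lam beta F x0 eps (Eiter lam k z)) \/
  is_endpoint lam z.
Proof.
  intros hx0 hz; apply NNPP; intros hno.
  assert (hzz : on_hair (turn z) z) by (split; auto).
  destruct (escape_rate_exists z hz) as [t0 ht0].
  apply hno; right; apply (minimal_is_endpoint z t0 hz ht0).
  intros w hw hne; destruct (ahead_total (turn z) z w hzz hw hne) as [h | h]; auto.
  exfalso; apply hno; left; apply (ahead_in_X (turn z) w z x0); auto.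
Qed.

End Poincare.

End Dynamics.

Theorem theorem1p4 (lam beta : R) (S : R -> R) (x0 : R) (z : Cx) :
  0 < lam -> lam < exp (-1) ->
  lam * exp beta = beta -> 1 < beta ->
  (forall t, S (beta * t) = lam * exp (S t)) ->
  S 0 = beta -> derivable_pt_lim S 0 1 ->
  (forall s t, s < t -> S s < S t) ->
  beta < x0 ->
  in_Julia lam z -> ~ is_endpoint lam z ->
  exists (eps : R) (k : nat), 0 < eps /\ in_X lam beta S x0 eps (Eiter lam k z).
Proof.
  intros hl hl1 hb hb1 hS hS0 hSd hSi hx0 hJ hE.
  pose proof (good_of_Julia lam beta hl hl1 hb hb1 z hJ) as hz.
  destruct (in_X_or_endpoint lam beta hl hl1 hb hb1 S hS hS0 hSd hSi x0 z hx0 hz); tauto.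
Qed.
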